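(* Consider the one-field Friedrichs' system and its $hp$-HDG formulation (L)–(G) described in the context. Suppose that 1. assumptions (A.1)–(A.4) of the context hold and $M\ge0$ on $\partial\Omega$; 2. $\mathcal N(A)=\{\mathbf 0\}$ on the mesh skeleton, where $\mathcal N$ denotes the null space. Then there exists a unique solution $\widehat{\mathbf z}_h\in\widehat{\mathbf W}_h$ of the $hp$-HDG formulation, i.e. a unique $\widehat{\mathbf z}_h\in\widehat{\mathbf W}_h$ for which there is $\mathbf z_h\in\mathbf W_h$ such that $(\mathbf z_h,\widehat{\mathbf z}_h)$ satisfies (L)–(G).
   Context: Mesh and spaces. $\Omega\subset\mathbb R^d$ is a Lipschitz domain and $\mathcal T_h$ is a finite partition of $\Omega$ into disjoint elements $K$ with straight edges/faces (triangles in the paper's exposition; tetrahedra, quadrilaterals, hexahedra are also allowed), $\bigcup_K\overline K=\overline\Omega$; hanging nodes are allowed. $\mathbf n=(n_1,\dots,n_d)^T$ is the unit outward normal on $\partial K$. An interior mortar is a set $e=\partial K^+\cap\partial K^-$ of positive $(d-1)$-dimensional measure, contained in one face of each of $K^\pm$ (on a nonconforming interface the mortars are the smaller faces, ''split-sided'' mortars); a boundary mortar is $e=\partial K\cap\partial\Omega$ (face by face). $\mathcal E_h=\mathcal E_h^\circ\cup\mathcal E_h^\partial$ is the set of interior and boundary mortars (the mesh skeleton). Each $K$ carries a polynomial degree $p_K$; $p_e=\max\{p_{K^+},p_{K^-}\}$ for $e\in\mathcal E_h^\circ$, and $p_e=p_K$ for a boundary mortar $e\subset\partial K$. $\mathcal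 P^p(D)$ is the space of polynomials of degree at most $p$ on $D$. $P_h=\{v\in L^2(\mathcal T_h): v|_K\in\mathcal P^{p_K}(K)\ \forall K\}$, $\widehat P_h=\{v\in L^2(\mathcal E_h): v|_e\in\mathcal P^{p_e}(e)\ \forall e\}$, $\mathbf W_h=[P_h]^m$, $\widehat{\mathbf W}_h=[\widehat P_h]^m$. $(\cdot,\cdot)_D$ and $\langle\cdot,\cdot\rangle_D$ are $L^2$ inner products over $d$- and $(d-1)$-dimensional sets; $(\cdot,\cdot)_{\mathcal T_h}=\sum_K(\cdot,\cdot)_K$, $\langle\cdot,\cdot\rangle_{\partial K}$ is the sum over the mortars in $\partial K$, $\langle\cdot,\cdot\rangle_{\partial\mathcal T_h}=\sum_K\langle\cdot,\cdot\rangle_{\partial K}$, and $\langle\cdot,\cdot\rangle_{\mathcal E_h}$, $\langle\cdot,\cdot\rangle_{\mathcal E_h^\partial}$ are sums over mortars. The jump is $[\![f]\!]=f^-+f^+$ on interior mortars (traces from the two sides; normal-dependent quantities use the outward normal of the respective element) and $[\![f]\!]=f$ on boundary mortars. One-field Friedrichs' system $\sum_{k=1}^d\partial_k(A_k\mathbf z)+G\mathbf z=\mathbf f$ in $\Omega$, $\mathbf z$ with values in $\mathbb R^m$, $\mathbf f\in[L^2(\Omega)]^m$. Assumptions: (A.1) $G\in[L^\infty(\Omega)]^{m,m}$; (A.2) $A_k\in[L^\infty(\Omega)]^{m,m}$ for all $k$ and $\sum_k\partial_kA_k\in[L^\infty(\Omega)]^{m,m}$; (A.3) $A_k=A_k^T$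 a.e. in $\Omega$ for all $k$; (A.4) there is $\mu_0>0$ with $G+G^T+\sum_k\partial_kA_k\ge 2\mu_0I_m$ a.e. in $\Omega$ (matrix inequalities mean positive semidefiniteness of the difference). On $\partial K$ put $A=\sum_kn_kA_k$ and $|A|=R|\Lambda|R^{-1}$, where $A=R\Lambda R^{-1}$ is an eigendecomposition of the symmetric matrix $A$. $A$ is assumed continuous across the mesh skeleton (up to the sign change of the normal). On $\partial\Omega$, $M:=|A|$ and $\mathbf g:\partial\Omega\to\mathbb R^m$ is boundary data ($\mathbf g$ equals Dirichlet data $\mathbf g_D$ where $A-M\ne0$ and $\mathbf 0$ where $A-M=0$; the homogeneous case is $\mathbf g_D=\mathbf 0$). One-field $hp$-HDG formulation: find $(\mathbf z_h,\widehat{\mathbf z}_h)\in\mathbf W_h\times\widehat{\mathbf W}_h$ such that for all $(\mathbf w_h,\widehat{\mathbf w}_h)\in\mathbf W_h\times\widehat{\mathbf W}_h$ (L) $-\sum_k(A_k\mathbf z_h,\partial_k\mathbf w_h)_{\mathcal T_h}+(G\mathbf z_h,\mathbf w_h)_{\mathcal T_h}+\langle A\mathbf z_h+|A|(\mathbf z_h-\widehat{\mathbf z}_h),\mathbf w_h\rangle_{\partial\mathcal T_h}=(\mathbf f,\mathbf w_h)_{\mathcal T_h}$, (G) $\langle[\![A\mathbf z_h+|A|(\mathbf z_h-\widehat{\mathbf z}_h)]\!],\widehat{\mathbf w}_h\rangle_{\mathcal E_h}=-\langle\tfrac12(A-M)\mathbf g,\widehat{\mathbf w}_h\rangle_{\mathcal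 E_h^\partial}+\langle\tfrac12(A+M)\widehat{\mathbf z}_h,\widehat{\mathbf w}_h\rangle_{\mathcal E_h^\partial}$. *)

(* Defs.v *)
From HB Require Import structures.
From mathcomp Require Import all_boot all_order all_algebra.
From mathcomp Require Import all_classical all_reals all_analysis.
From mathcomp Require Import measurable_realfun.
From mathcomp Require mpoly.
Import (canonicals, coercions) mpoly.

Set Implicit Arguments.
Unset Strict Implicit.
Unset Printing Implicit Defensive.

Import Order.TTheory GRing.Theory Num.Theory.
Import numFieldNormedType.Exports.

Local Open Scope classical_set_scope.
Local Open Scope ring_scope.

(* Matrices carry the product sigma-algebra of their entries (the Borel
   sigma-algebra), so that 'rV[R]_n is a measurable space. *)

Definition mx_coord {R : realType} m n (k : 'I_#|{: 'I_m * 'I_n}|)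
    (M : 'M[R]_(m, n)) : R :=
  M (enum_val k).1 (enum_val k).2.

Section mx_measurable.
Context {R : realType} (m n : nat).

Let mx0 : g_sigma_preimage (@mx_coord R m n) set0.
Proof. exact: sigma_algebra0. Qed.

Let mxC A : g_sigma_preimage (@mx_coord R m n) A ->
  g_sigma_preimage (@mx_coord R m n) (~` A).
Proof. exact: sigma_algebraC. Qed.

Let mxU (F : (set 'M[R]_(m, n))^nat) :
  (forall i, g_sigma_preimage (@mx_coord R m n) (F i)) ->
  g_sigma_preimage (@mx_coord R m n) (\bigcup_i (F i)).
Proof. exact: sigma_algebra_bigcup. Qed.

HB.instance Definition _ := @isMeasurable.Build default_measure_display
  'M[R]_(m, n) (g_sigma_preimage (@mx_coord R m n)) mx0 mxC mxU.

End mx_measurable.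

Lemma measurable_mx_entry {R : realType} m n (i : 'I_m) (j : 'I_n) :
  measurable_fun setT (fun M : 'M[R]_(m, n) => M i j).
Proof.
move=> _ Y mY; rewrite setTI; apply: sub_sigma_algebra => /=.
rewrite -bigcup_seq/=; exists (enum_rank (i, j)) => /=.
  by rewrite mem_index_enum.
by exists Y => //; rewrite setTI /mx_coord enum_rankK.
Qed.

Lemma measurable_fun_mx {R : realType} d (T : measurableType d) m n
    (f : T -> 'M[R]_(m, n)) :
  (forall i j, measurable_fun setT (fun x => f x i j)) -> measurable_fun setT f.
Proof.
move=> mf.
suff h : preimage_set_system setT f (g_sigma_preimage (@mx_coord R m n))
    `<=` measurable.
  by move=> _ A mA; apply: h; exists A.
rewrite -(g_sigma_preimage_comp (@mx_coord R m n)) /g_sigma_preimage.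
apply: smallest_sub; first exact: sigma_algebra_measurable.
rewrite -bigcup_seq; apply: bigcup_sub => i _ _ [B mB <-].
exact: mf.
Qed.

Section image_measure.
Context d1 d2 (T1 : measurableType d1) (T2 : measurableType d2) (R : realType).
Variables (f : T1 -> T2) (mf : measurable_fun setT f).
Variable mu : {measure set T1 -> \bar R}.

(* [pushforward], with the measurability of the map as an argument so that the
   measure structure can be inferred *)
Definition image_measure (_ : measurable_fun setT f) : set T2 -> \bar R :=
  pushforward mu f.

Let image_measure0 : image_measure mf set0 = 0%E.
Proof. exact: measure0. Qed.

Let image_measure_ge0 A : (0 <= image_measure mf A)%E.
Proof. exact: (@measure_ge0 _ _ _
  (measure_function_pushforward__canonical__measure_function_Measure mu mf)). Qed.

Let image_measure_sigma_additive : semi_sigma_additive (image_measure mf).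
Proof. exact: (@measure_semi_sigma_additive _ _ _
  (measure_function_pushforward__canonical__measure_function_Measure mu mf)). Qed.

HB.instance Definition _ := isMeasure.Build _ _ _ (image_measure mf)
  image_measure0 image_measure_ge0 image_measure_sigma_additive.

End image_measure.

Section lebesgue_rV.
Context {R : realType}.

Definition rV_cons n (u : 'rV[R]_n * measurableTypeR R) : 'rV[R]_n.+1 :=
  row_mx (u.2%:M : 'rV[R]_1) u.1.

Lemma measurable_rV_cons n : measurable_fun setT (@rV_cons n).
Proof.
apply: measurable_fun_mx => i j; rewrite /rV_cons.
have [k ->|k ->] := split_ordP (j : 'I_(1 + n)).
  rewrite (_ : (fun _ => _) = snd); first exact: measurable_snd.
  by apply/funext => u; rewrite (@row_mxEl _ 1 1 n) !ord1 mxE eqxx mulr1n.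
rewrite (_ : (fun _ => _) = (fun M : 'rV[R]_n => M i k) \o fst).
  by apply: measurableT_comp; [exact: measurable_mx_entry|exact: measurable_fst].
by apply/funext => u; rewrite (@row_mxEr _ 1 1 n).
Qed.

Fixpoint lebesgue_rV n : {measure set 'rV[R]_n -> \bar R} :=
  if n is n'.+1 then
    image_measure (lebesgue_rV n' \x @lebesgue_measure R)%E
      (@measurable_rV_cons n')
  else \d_(0 : 'rV[R]_0).

End lebesgue_rV.
Arguments lebesgue_rV : clear implicits.

(* the Euclidean inner product, both for points ('rV) and for values ('cV) *)
Definition inner {R : realType} p q (u v : 'M[R]_(p, q)) : R :=
  \sum_i \sum_j u i j * v i j.

Section hyperplane_area.
Context {R : realType} {d : nat}.

Definition hyperplane (nu : 'rV[R]_d) (c : R) : set 'rV[R]_d :=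
  [set x | inner nu x = c].

Definition slab (nu : 'rV[R]_d) (c : R) : set 'rV[R]_d :=
  [set x | c <= inner nu x <= c + 1].

Definition hyperplane_proj (nu : 'rV[R]_d) (c : R) (x : 'rV[R]_d) : 'rV[R]_d :=
  x - (inner nu x - c) *: nu.

Lemma measurable_inner (nu : 'rV[R]_d) : measurable_fun setT (inner nu).
Proof.
apply: measurable_sum => i; apply: measurable_sum => j.
by apply: measurable_funM => //; exact: measurable_mx_entry.
Qed.

Lemma measurable_slab nu c : measurable (slab nu c).
Proof.
rewrite (_ : slab nu c = inner nu @^-1` `[c, c + 1]).
  by rewrite -[X in measurable X]setTI; exact: measurable_inner.
by apply/seteqP; split => x /=; rewrite in_itv.
Qed.

Lemma measurable_hyperplane_proj nu c :
  measurable_fun setT (hyperplane_proj nu c).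
Proof.
apply: measurable_fun_mx => i j.
rewrite (_ : (fun _ => _) =
    (fun x : 'rV[R]_d => x i j - (inner nu x - c) * nu i j)).
  apply: measurable_funB; first exact: measurable_mx_entry.
  apply: measurable_funM => //; apply: measurable_funB => //.
  exact: measurable_inner.
by apply/funext => x; rewrite !mxE.
Qed.

(* (d-1)-dimensional surface measure on the hyperplane [hyperplane nu c], for
   a unit vector nu: the area of a set is the volume of the right prism of
   height 1 erected on it. *)
Definition hyperplane_area (nu : 'rV[R]_d) (c : R) :
    {measure set 'rV[R]_d -> \bar R} :=
  image_measure (mrestr (lebesgue_rV R d) (measurable_slab nu c))
    (measurable_hyperplane_proj nu c).

End hyperplane_area.

Section functions.
Context {R : realType} {d : nat}.
Local Notation pt := 'rV[R]_d.

Definition frontier (S : set pt) : set pt := closure S `\` S°.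

Definition Linf (mu : {measure set pt -> \bar R}) (D : set pt) (f : pt -> R) :=
  measurable_fun D f /\ exists C : R, \forall x \ae mu, D x -> `|f x| <= C.

Definition L2 (mu : {measure set pt -> \bar R}) (D : set pt) (f : pt -> R) :=
  measurable_fun D f /\ mu.-integrable D (fun x => (f x ^+ 2)%:E).

Definition partial (k : 'I_d) (f : pt -> R) (x : pt) : R :=
  'D_(delta_mx 0 k : pt) f x.

Definition partial_vec m (k : 'I_d) (w : pt -> 'cV[R]_m) (x : pt) : 'cV[R]_m :=
  \col_i partial k (fun y => w y i 0) x.

Fixpoint Ck (n : nat) (f : pt -> R) : Prop :=
  continuous f /\
  (if n is n'.+1 then
     forall k, (forall x, derivable f x (delta_mx 0 k : pt)) /\
               Ck n' (partial k f)
   else True).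

Definition smooth (f : pt -> R) := forall n, Ck n f.

(* C_c^oo(Omega) *)
Definition test_function (Omega : set pt) (f : pt -> R) :=
  [/\ smooth f, compact (closure [set x | f x != 0]) &
      closure [set x | f x != 0] `<=` Omega].

(* Near each boundary point Omega is, up to a rotation, the region above the
   graph of a Lipschitz function: the height is measured along nu, and g is
   only evaluated on the hyperplane orthogonal to nu. *)
Definition lipschitz_domain (Omega : set pt) :=
  [/\ open Omega, connected Omega, Omega !=set0, bounded_set Omega &
    forall x, frontier Omega x ->
      exists (nu : pt) (g : pt -> R) (L : R),
        [/\ inner nu nu = 1,
            forall y z, `|g y - g z| <= L * `|y - z| &
            \forall y \near x,
              Omega y <-> g (y - inner nu y *: nu) < inner nu y]].

(* divA is the distributional divergence \sum_k \partial_k A_k on Omega *)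
Definition weak_divergence m (Omega : set pt) (A : 'I_d -> pt -> 'M[R]_m)
    (divA : pt -> 'M[R]_m) :=
  forall phi, test_function Omega phi -> forall i j,
    \sum_k \int[lebesgue_rV R d]_(x in Omega) (A k x i j * partial k phi x)
    = - \int[lebesgue_rV R d]_(x in Omega) (divA x i j * phi x).

(* v is on S a vector of polynomials of total degree at most p ([msize] is one
   more than the total degree); on a flat (d-1)-dimensional set S these are
   the polynomials of degree at most p in d-1 Cartesian coordinates of S. *)
Definition poly_on m (p : nat) (S : set pt) (v : pt -> 'cV[R]_m) :=
  forall i, exists2 P : mpoly.mpoly d R, (mpoly.msize P <= p.+1)%N &
    forall x, S x -> v x i 0 = mpoly.meval (x 0) P.

End functions.

Section matrices.
Context {R : realType} {m : nat}.

Definition psdmx (B : 'M[R]_m) := forall v : 'cV[R]_m, 0 <= inner v (B *m v).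

(* B = P |D| P^-1 for some eigendecomposition A = P D P^-1 *)
Definition is_absmx (A B : 'M[R]_m) :=
  exists (P : 'M[R]_m) (L : 'rV[R]_m),
    [/\ P \in unitmx, A = P *m diag_mx L *m invmx P &
        B = P *m diag_mx (map_mx Num.norm L) *m invmx P].

(* |A|, set to 0 if A is not diagonalizable; B in [is_absmx] does not depend on
   the chosen eigendecomposition *)
Definition absmx (A : 'M[R]_m) : 'M[R]_m := xget 0 [set B | is_absmx A B].

End matrices.

Section mesh.
Context {R : realType} {d : nat}.
Local Notation pt := 'rV[R]_d.

(* near x, K is the half-space behind the hyperplane through x normal to nu *)
Definition outward_normal (K : set pt) (x nu : pt) :=
  inner nu nu = 1 /\ \forall y \near x, K y <-> inner nu (y - x) < 0.

(* Polyhedral elements, not necessarily convex, together with their flat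
   faces. *)
Record element := Element {
  region : set pt;
  nface : nat;
  face_set : 'I_nface -> set pt;
  face_normal : 'I_nface -> pt;
  face_offset : 'I_nface -> R;
  region_open : open region;
  region_connected : connected region;
  region_neq0 : region !=set0;
  region_bounded : bounded_set region;
  face_closed : forall i, closed (face_set i);
  face_unit : forall i, inner (face_normal i) (face_normal i) = 1;
  face_flat : forall i,
    face_set i `<=` hyperplane (face_normal i) (face_offset i);
  face_outward : forall i, face_set i `<=`
    closure (face_set i `&`
             [set x | outward_normal region x (face_normal i)]);
  face_cover : frontier region = \bigcup_i face_set i;
  face_overlap : forall i j, i != j ->
    hyperplane_area (face_normal i) (face_offset i)
      (face_set i `&` face_set j) = 0%E
}.

Record mesh (Omega : set pt) := Mesh {
  nelt : nat;
  elt : 'I_nelt -> element;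
  elt_sub : forall K, region (elt K) `<=` Omega;
  elt_disjoint : forall K K', K != K' ->
    region (elt K) `&` region (elt K') = set0;
  elt_cover : \bigcup_K closure (region (elt K)) = closure Omega
}.

Variables (Omega : set pt) (T : mesh Omega).

Definition cell (K : 'I_(nelt T)) : set pt := region (elt K).

(* a face of the mesh is a face of an element: the first component is the
   element it is seen from *)
Definition face := {K : 'I_(nelt T) & 'I_(nface (elt K))}.

Definition facet (f : face) : set pt := face_set (tagged f).
Definition facet_normal (f : face) : pt := face_normal (tagged f).
Definition facet_area (f : face) : {measure set pt -> \bar R} :=
  hyperplane_area (face_normal (tagged f)) (face_offset (tagged f)).

(* inl (f1, f2): the part of dK^+ `&` dK^- in the face f1 of K^+ and the face
   f2 of K^-; inr f: the part of the face f on the boundary of Omega. The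
   mortars are the indices selected by [is_mortar]. *)
Definition mortar := (face * face + face)%type.

Definition mortar_set (e : mortar) : set pt :=
  match e with
  | inl (f1, f2) => facet f1 `&` facet f2
  | inr f => facet f `&` frontier Omega
  end.

(* the surface measure used on e; for an interior mortar f1 and f2 lie in the
   same hyperplane *)
Definition mortar_area (e : mortar) : {measure set pt -> \bar R} :=
  match e with inl (f1, _) => facet_area f1 | inr f => facet_area f end.

(* each interior mortar is counted once: K^+ has the smaller index *)
Definition is_mortar (e : mortar) : bool :=
  (if e is inl (f1, f2) then (tag f1 < tag f2)%N else true) &&
  `[< (0 < mortar_area e (mortar_set e))%E >].

Definition side (e : mortar) (f : face) : bool :=
  match e with
  | inl (f1, f2) => (f == f1) || (f == f2)
  | inr f1 => f == f1
  end.

(* <F, 1>_{dK}, F being evaluated from inside K *)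
Definition boundary_integral (K : 'I_(nelt T)) (F : mortar -> face -> pt -> R)
    : R :=
  \sum_(e | is_mortar e) \sum_(f | side e f && (tag f == K))
    \int[mortar_area e]_(x in mortar_set e) F e f x.

Definition mdegree (p : 'I_(nelt T) -> nat) (e : mortar) : nat :=
  match e with
  | inl (f1, f2) => maxn (p (tag f1)) (p (tag f2))
  | inr f => p (tag f)
  end.

End mesh.

Section hdg.
Context {R : realType} {d m : nat} {Omega : set 'rV[R]_d}.
Local Notation pt := 'rV[R]_d.
Variables (T : mesh Omega) (p : 'I_(nelt T) -> nat).

(* Elementwise polynomial fields; the polynomial on K is extended to dK, which
   gives the trace from K. *)
Definition Wh (w : 'I_(nelt T) -> pt -> 'cV[R]_m) :=
  forall K, poly_on (p K) (closure (cell K)) (w K).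

Definition What (wh : mortar T -> pt -> 'cV[R]_m) :=
  forall e, is_mortar e -> poly_on (mdegree p e) (mortar_set e) (wh e).

(* A = \sum_k n_k A_k on a face, bA being the boundary values of the A_k *)
Definition normal_mx (bA : face T -> 'I_d -> pt -> 'M[R]_m)
    (f : face T) (x : pt) : 'M[R]_m :=
  \sum_k facet_normal f 0 k *: bA f k x.

(* Fields A_k in L^oo with divergence in L^oo have boundary values on dK only
   in the sense of normal traces: bA are boundary values of A when
   \sum_k n_k bA_k is the normal trace of A on dK, i.e. Green's formula
   holds. *)
Definition boundary_values (A : 'I_d -> pt -> 'M[R]_m) (divA : pt -> 'M[R]_m)
    (bA : face T -> 'I_d -> pt -> 'M[R]_m) :=
  (forall e f, is_mortar e -> side e f -> forall k i j,
     Linf (mortar_area e) (mortar_set e) (fun x => bA f k x i j)) /\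
  forall K (phi : pt -> R), smooth phi -> forall i j,
    \sum_k \int[lebesgue_rV R d]_(x in cell K) (A k x i j * partial k phi x)
    + \int[lebesgue_rV R d]_(x in cell K) (divA x i j * phi x)
    = boundary_integral K (fun _ f x => normal_mx bA f x i j * phi x).

Variables (G : pt -> 'M[R]_m) (A : 'I_d -> pt -> 'M[R]_m).
(* B is the matrix A = \sum_k n_k A_k on the faces *)
Variables (B : face T -> pt -> 'M[R]_m) (f0 : pt -> 'cV[R]_m).
Variable gD : pt -> 'cV[R]_m.

Definition boundary_data (f : face T) (x : pt) : 'cV[R]_m :=
  if B f x - absmx (B f x) == 0 then 0 else gD x.

Section equations.
Variables (z : 'I_(nelt T) -> pt -> 'cV[R]_m) (zh : mortar T -> pt -> 'cV[R]_m).

Definition flux (e : mortar T) (f : face T) (x : pt) : 'cV[R]_m :=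
  B f x *m z (tag f) x + absmx (B f x) *m (z (tag f) x - zh e x).

Definition local_equation := forall w, Wh w ->
  - (\sum_K \sum_k \int[lebesgue_rV R d]_(x in cell K)
       inner (A k x *m z K x) (partial_vec k (w K) x))
  + \sum_K \int[lebesgue_rV R d]_(x in cell K) inner (G x *m z K x) (w K x)
  + \sum_K boundary_integral K (fun e f x => inner (flux e f x) (w K x))
  = \sum_K \int[lebesgue_rV R d]_(x in cell K) inner (f0 x) (w K x).

Definition global_equation := forall wh, What wh ->
  \sum_(e | is_mortar e)
    \int[mortar_area e]_(x in mortar_set e) inner (\sum_(f | side e f) flux e f x) (wh e x)
  = - (\sum_(f : face T | is_mortar (inr f))
         \int[mortar_area (inr f)]_(x in mortar_set (inr f))
           inner (2^-1 *: ((B f x - absmx (B f x)) *m boundary_data f x))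
                 (wh (inr f) x))
    + \sum_(f : face T | is_mortar (inr f))
        \int[mortar_area (inr f)]_(x in mortar_set (inr f))
          inner (2^-1 *: ((B f x + absmx (B f x)) *m zh (inr f) x))
                (wh (inr f) x).

Definition hdg_solution :=
  [/\ Wh z, What zh, local_equation & global_equation].

End equations.

End hdg.

(* Main.v *)
Require Import Defs.
From mathcomp Require Import all_boot all_order all_algebra.
From mathcomp Require Import all_classical all_reals all_analysis.
From mathcomp Require Import measurable_realfun spectral complex ring lra.
From mathcomp Require mpoly.
Import (canonicals, coercions) mpoly.

Set Implicit Arguments.
Unset Strict Implicit.
Unset Printing Implicit Defensive.

Import Order.TTheory GRing.Theory Num.Theory.
Import numFieldNormedType.Exports.

Local Open Scope classical_set_scope.
Local Open Scope ring_scope.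

(* On a pair (z, zh), the bilinear form of (L) minus (G) satisfies, by Green's
   formula applied to the products z_i z_j, the energy identity
     a((z, zh), (z, zh)) = sum_K int_K (G z . z + 1/2 (div A) z . z)
       + sum_e sum_(K next to e) int_e (|A| + 1/2 A)(z - zh) . (z - zh)
       + 1/2 sum_(e on the boundary) int_e |A| zh . zh,
   the interior terms A zh . zh cancelling because A changes sign with the
   normal. All the terms are nonnegative, and |A| + 1/2 A is definite because A
   has no kernel, so a vanishes at (z, zh) only if z = 0 and zh = 0 a.e. This
   gives uniqueness, and, the problem being a square linear system, existence.

   The matrix |A| is only an epsilon-choice of an eigendecomposition; it is
   measurable in x because it is a limit of matrix polynomials in A(x), and this
   holds only where A(x) is symmetric. As the integral of a nonmeasurable
   function is still defined, every integral is first restricted to the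
   complement of a null set, off which all the a.e. hypotheses hold everywhere. *)

(** * Symmetric matrices and their absolute values *)

(** The linear system is square but in general singular. The trace on a mortar is encoded by a
    polynomial in all [d] variables, and many of these agree on a flat set, so the monomials
    generate the discrete space without being a basis. Solvability comes from the Fredholm
    alternative: a kernel vector of the matrix yields a pair with a(u, u) = 0, hence z = 0 and zh =
    0 a.e. on the mortars, and the load, which sees only these values, vanishes there too. For the
    same reason uniqueness concerns the values of zh on each mortar and not the polynomials behind
    them.

    The factors 1/2 come from the symmetry of the A_k: A_k z . d_k z is half the sum over i, j of
    the entries (A_k)_ij times d_k (z_i z_j), a form to which Green's formula for scalar test
    functions applies. It trades the derivative term of (L) for +1/2 div A in the cells and -1/2 A z
    . z on the faces. The flux tested with the gap z - zh produces |A| + A on the gap, and the face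
    term lowers this to |A| + 1/2 A, whose eigenvalues |t| + t/2 are at least |t|/2 for either sign
    of t. *)

Lemma symmetric_diagonalizable (R : rcfType) m (A : 'M[R]_m) : A = A^T ->
  exists (P : 'M[R]_m) (L : 'rV[R]_m),
    P \in unitmx /\ A = P *m diag_mx L *m invmx P.
Proof.
case: m A => [|m] A symA.
  by exists 1%:M, 0; rewrite unitmx1; split=> //; apply/matrixP => -[].
(* Over the complex numbers A is Hermitian, so it is unitarily diagonalizable with real spectrum;
   the diagonalizing matrix, however, is complex. *)
pose f := real_complex R; pose Ac := map_mx f A.
have hermA : Ac \is hermsymmx.
  apply: realsym_hermsym.
    apply/is_hermitianmxP; rewrite expr0 scale1r -[RHS]/(map_mx idfun Ac^T).
    by rewrite map_mx_id// /Ac map_trmx -symA.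
  by apply/mxOverP => i j; rewrite mxE complex_real.
have /orthomx_spectralP dA := hermitian_normalmx hermA.
have /mxOverP realL := hermitian_spectral_diag_real hermA.
set Q := spectralmx Ac in dA; set D := spectral_diag Ac in dA realL.
pose t j := complex.Re (D 0 j).
have tE j : D 0 j = f (t j) by rewrite /t /f; exact: esym (RRe_real (realL 0 j)).
pose rs := undup [seq t j | j <- enum 'I_m.+1].
pose q := \prod_(r <- rs) ('X - r%:P).
(* What descends to the real field is the annihilating polynomial [q]: it is split with simple
   roots, duplicates having been removed from the spectrum, and this makes A diagonalizable over the
   reals. *)
have /mxminpoly_minP qA : horner_mx A q = 0.
  apply: (@map_mx_inj _ _ f); rewrite map_horner_mx map_mx0 -/Ac dA.
  rewrite horner_mx_uconjC ?spectral_unit// horner_mx_diag.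
  rewrite (_ : map_mx _ _ = 0) ?linear0 ?mulmx0 ?mul0mx//.
  apply/rowP => j; rewrite !mxE tE horner_map/= (_ : q.[t j] = 0) ?rmorph0//.
  by apply/eqP; rewrite -/(root q (t j)) root_prod_XsubC mem_undup map_f ?mem_enum.
have /diagonalizableP [P uP] : exists2 rs, uniq rs & mxminpoly A %| \prod_(x <- rs) ('X - x%:P).
  by exists rs => //; exact: undup_uniq.
move=> /(diagonalizable_forLR uP)[L ->]; exists (invmx P), L.
by rewrite unitmx_inv uP invmxK mxpoly.conjVmx.
Qed.

Section functional_calculus.
Context {R : realType} {m : nat}.
Implicit Types (A P : 'M[R]_m) (L : 'rV[R]_m) (phi psi : R -> R).

Definition spectral_map P L phi : 'M[R]_m :=
  P *m diag_mx (map_mx phi L) *m invmx P.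

Lemma spectral_map_id P L : spectral_map P L id = P *m diag_mx L *m invmx P.
Proof. by rewrite /spectral_map map_mx_id. Qed.

Lemma spectral_mapM P L phi psi : P \in unitmx ->
  spectral_map P L phi *m spectral_map P L psi =
  spectral_map P L (fun t => phi t * psi t).
Proof.
move=> uP; rewrite /spectral_map !mulmxA mulmxKV// -(mulmxA P) mulmx_diag.
by congr (P *m diag_mx _ *m _); apply/rowP => j; rewrite !mxE.
Qed.

Lemma spectral_mapD P L phi psi :
  spectral_map P L phi + spectral_map P L psi =
  spectral_map P L (fun t => phi t + psi t).
Proof.
rewrite /spectral_map -mulmxDl -mulmxDr -raddfD.
by congr (P *m diag_mx _ *m _); apply/rowP => j; rewrite !mxE.
Qed.

Lemma spectral_mapZ P L a phi :
  a *: spectral_map P L phi = spectral_map P L (fun t => a * phi t).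
Proof.
rewrite /spectral_map scalemxAl scalemxAr -linearZ.
by congr (P *m diag_mx _ *m _); apply/rowP => j; rewrite !mxE.
Qed.

(* A being symmetric, P^T P commutes with diag L, hence vanishes at the entries
   (i, j) with L_i <> L_j, hence commutes with diag (phi L). *)
Lemma spectral_map_sym P L phi : P \in unitmx ->
  P *m diag_mx L *m invmx P = (P *m diag_mx L *m invmx P)^T ->
  (spectral_map P L phi)^T = spectral_map P L phi.
Proof.
move=> uP symA; pose S := P^T *m P.
have comS : diag_mx L *m S = S *m diag_mx L.
  have := congr1 (fun X => P^T *m X *m P) symA.
  by rewrite /S !trmx_mul !tr_diag_mx trmx_inv !mulmxA mulmxKV// mulmxV ?unitmx_tr// mul1mx => ->.
suff comphi : diag_mx (map_mx phi L) *m S = S *m diag_mx (map_mx phi L).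
  rewrite /spectral_map !trmx_mul tr_diag_mx trmx_inv.
  apply: (can_inj (mulKmx (_ : P^T \in unitmx))); first by rewrite unitmx_tr.
  apply: (can_inj (mulmxK uP)).
  by rewrite !mulmxA mulmxKV// mulmxV ?unitmx_tr// mul1mx -!mulmxA -/S comphi !mulmxA.
apply/matrixP => i j; move/matrixP/(_ i j): comS.
rewrite !mul_diag_mx !mul_mx_diag !mxE => /eqP.
rewrite mulrC -subr_eq0 -mulrBr mulf_eq0 => /orP[/eqP->|]; first by rewrite mul0r mulr0.
by rewrite subr_eq0 => /eqP->; rewrite mulrC.
Qed.

Lemma inner_ge0 p q (u : 'M[R]_(p, q)) : 0 <= inner u u.
Proof. by do 2!apply: sumr_ge0 => ? _; rewrite -expr2 sqr_ge0. Qed.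

Lemma inner_eq0 p q (u : 'M[R]_(p, q)) : inner u u = 0 -> u = 0.
Proof.
move=> u0; apply/matrixP => i j; rewrite mxE; apply/eqP.
have ge0 k : true -> 0 <= \sum_l u k l * u k l.
  by move=> _; apply: sumr_ge0 => l _; rewrite -expr2 sqr_ge0.
move/eqP: u0; rewrite /inner psumr_eq0// => /allP/(_ i).
rewrite mem_index_enum psumr_eq0; last by move=> l _; rewrite -expr2 sqr_ge0.
by move=> /(_ isT)/allP/(_ j); rewrite mem_index_enum => /(_ isT); rewrite -expr2 sqrf_eq0.
Qed.

Lemma innerE (u v : 'cV[R]_m) : inner u v = (u^T *m v) 0 0.
Proof. by rewrite mxE; apply: eq_bigr => i _; rewrite big_ord1 mxE. Qed.

Lemma innerC p q (u v : 'M[R]_(p, q)) : inner u v = inner v u.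
Proof. by do 2!apply: eq_bigr => ? _; rewrite mulrC. Qed.

Lemma inner_mulmx A (u v : 'cV[R]_m) : inner u (A *m v) = inner (A^T *m u) v.
Proof. by rewrite !innerE trmx_mul trmxK mulmxA. Qed.

(** The quadratic form is the squared norm of F v, where F is the symmetric square root obtained by
    applying the square root of [phi] to the eigenvalues. *)
Lemma spectral_map_psd P L phi : P \in unitmx ->
  P *m diag_mx L *m invmx P = (P *m diag_mx L *m invmx P)^T ->
  (forall t, 0 <= phi t) -> psdmx (spectral_map P L phi).
Proof.
move=> uP symA phi0 v; pose F := spectral_map P L (fun t => Num.sqrt (phi t)).
have -> : spectral_map P L phi = F *m F.
  rewrite spectral_mapM// /spectral_map; congr (P *m diag_mx _ *m _).
  by apply/rowP => j; rewrite !mxE -expr2 sqr_sqrtr.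
by rewrite -(mulmxA F F v) inner_mulmx (_ : F^T = F) ?inner_ge0// spectral_map_sym.
Qed.

(* For psi >= 0, F := sqrt(psi)(A) is symmetric and psi(A) = F^2. *)
Lemma spectral_map_inner_eq0 P L psi (v : 'cV[R]_m) : P \in unitmx ->
  P *m diag_mx L *m invmx P = (P *m diag_mx L *m invmx P)^T ->
  (forall t, 0 <= psi t) ->
  inner v (spectral_map P L psi *m v) = 0 -> spectral_map P L psi *m v = 0.
Proof.
move=> uP symA psi0; pose F := spectral_map P L (fun t => Num.sqrt (psi t)).
have -> : spectral_map P L psi = F *m F.
  rewrite spectral_mapM// /spectral_map; congr (P *m diag_mx _ *m _).
  by apply/rowP => j; rewrite !mxE -expr2 sqr_sqrtr.
have symF : F^T = F by exact: spectral_map_sym.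
by rewrite -(mulmxA F F v) inner_mulmx symF => /inner_eq0 ->; rewrite mulmx0.
Qed.

End functional_calculus.

Section absolute_value.
Context {R : realType} {m : nat}.
Implicit Type A : 'M[R]_m.

Lemma absmx_spectral A : A = A^T -> exists (P : 'M[R]_m) (L : 'rV[R]_m),
  [/\ P \in unitmx, A = spectral_map P L id & absmx A = spectral_map P L Num.norm].
Proof.
move=> symA; have [P [L [uP AE]]] := symmetric_diagonalizable symA.
have : is_absmx A (absmx A).
  have : is_absmx A (P *m diag_mx (map_mx Num.norm L) *m invmx P).
    by exists P, L.
  move=> h; apply: (@xgetPex _ 0 [set B | is_absmx A B]).
  by exists (P *m diag_mx (map_mx Num.norm L) *m invmx P).
(* The chosen value carries an eigendecomposition of its own; that one is returned, rather than the
   one which showed [is_absmx] to be inhabited. *)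
move=> [P' [L' [uP' AE' BE']]]; exists P', L'.
by rewrite spectral_map_id.
Qed.

Lemma absmx_psd A : A = A^T -> psdmx (absmx A).
Proof.
move=> symA; have [P [L [uP AE ->]]] := absmx_spectral symA.
by apply: spectral_map_psd => //; rewrite -spectral_map_id -AE.
Qed.

Lemma absmx_half_psd A : A = A^T -> psdmx (absmx A + 2^-1 *: A).
Proof.
move=> symA; have [P [L [uP AE ->]]] := absmx_spectral symA.
rewrite AE spectral_mapZ spectral_mapD.
apply: spectral_map_psd => //; first by rewrite -spectral_map_id -AE.
move=> t; have := ler_norm (- t); rewrite normrN; have := normr_ge0 t; lra.
Qed.

Lemma absmx_half_definite A (v : 'cV[R]_m) : A = A^T ->
  (forall w : 'cV[R]_m, A *m w = 0 -> w = 0) ->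
  inner v ((absmx A + 2^-1 *: A) *m v) = 0 -> v = 0.
Proof.
move=> symA kerA; have [P [L [uP AE ->]]] := absmx_spectral symA.
rewrite AE spectral_mapZ spectral_mapD => /spectral_map_inner_eq0 h.
have {}h : spectral_map P L (fun t => `|t| + 2^-1 * t) *m v = 0.
  apply: h => //; first by rewrite -spectral_map_id -AE.
  move=> t; have := ler_norm (- t); rewrite normrN; have := normr_ge0 t; lra.
apply: kerA; rewrite AE.
(* |t| + t/2 equals 3t/2 for t >= 0 and -t/2 for t < 0; [chi] is the factor that turns it back into
   t, so the kernel of |A| + 1/2 A lies in that of A. *)
pose chi (t : R) : R := if 0 <= t then (3/2)^-1 else - (2^-1)^-1.
suff -> : spectral_map P L id =
    spectral_map P L chi *m spectral_map P L (fun t => `|t| + 2^-1 * t).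
  by rewrite -mulmxA h mulmx0.
rewrite spectral_mapM// /spectral_map; congr (P *m diag_mx _ *m _).
by apply/rowP => j; rewrite !mxE /chi; case: (ger0P (L 0 j)) => _; field.
Qed.

(** |A| and A are symmetric with the same square, and the diagonal entries of this square are the
    squared Euclidean norms of their rows. *)
Lemma absmx_entry_le A i j : A = A^T -> `|absmx A i j| <= \sum_k \sum_l `|A k l|.
Proof.
move=> symA; have [P [L [uP AE BE]]] := absmx_spectral symA.
have symB : (absmx A)^T = absmx A.
  by rewrite BE spectral_map_sym// -spectral_map_id -AE.
have sqB : absmx A *m absmx A = A *m A.
  rewrite BE {1 2}AE !spectral_mapM// /spectral_map; congr (P *m diag_mx _ *m _).
  by apply/rowP => k; rewrite !mxE -expr2 real_normK ?num_real.
have sqE (X : 'M[R]_m) : X^T = X -> (X *m X) i i = \sum_k X i k ^+ 2.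
  move=> symX; rewrite mxE; apply: eq_bigr => k _.
  by rewrite -[in X in _ * X]symX mxE.
have rowE : \sum_k absmx A i k ^+ 2 = \sum_k A i k ^+ 2 by rewrite -!sqE ?sqB.
have ge0 (k : 'I_m) : 0 <= \sum_l `|A k l| by apply: sumr_ge0.
rewrite -(@ler_pXn2r _ 2) ?nnegrE//; last by apply: sumr_ge0.
rewrite real_normK ?num_real//.
apply: (@le_trans _ _ (\sum_k absmx A i k ^+ 2)).
  by rewrite (bigD1 j)//= lerDl; apply: sumr_ge0 => k _; rewrite sqr_ge0.
rewrite rowE; apply: (@le_trans _ _ ((\sum_l `|A i l|) ^+ 2)); last first.
  rewrite ler_pXn2r ?nnegrE//; first by rewrite [leRHS](bigD1 i)//= lerDl; apply: sumr_ge0.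
  by apply: sumr_ge0.
rewrite expr2 mulr_suml; apply: ler_sum => k _.
rewrite -(real_normK (num_real _)) expr2 ler_wpM2l//.
by rewrite (bigD1 k)//= lerDl; apply: sumr_ge0.
Qed.

(** Column i of [P] is an eigenvector for L_i; the bound compares the l1 norms of both sides of A p
    = L_i p. It gives the rescaling that brings the spectrum into [-1, 1], where Visser's iteration
    converges. *)
Lemma spectral_map_eigen_le (P : 'M[R]_m) (L : 'rV[R]_m) i : P \in unitmx ->
  `|L 0 i| <= \sum_k \sum_l `|spectral_map P L id k l|.
Proof.
move=> uP; set A := spectral_map P L id.
have AP : A *m P = P *m diag_mx L.
  by rewrite /A spectral_map_id mulmxKV.
pose S := \sum_k `|P k i|.
have S_gt0 : 0 < S.
  rewrite lt_neqAle sumr_ge0 ?andbT//; apply/eqP => /esym/eqP.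
  rewrite psumr_eq0// => /allP P0.
  (* A zero column i of [P] would make the i-th diagonal entry of P^-1 P vanish. *)
  have : row i (invmx P *m P) 0 i = 1 by rewrite mulVmx// !mxE eqxx.
  rewrite !mxE big1 => [/esym/eqP|k _]; first by rewrite oner_eq0.
  by move: (P0 k); rewrite mem_index_enum normr_eq0 => /(_ isT)/eqP ->; rewrite mulr0.
rewrite -(ler_pM2r S_gt0) mulr_sumr mulr_suml; apply: ler_sum => k _.
have /matrixP/(_ k i) := AP; rewrite mul_mx_diag !mxE mulrC -normrM => <-.
apply: (le_trans (ler_norm_sum _ _ _)); rewrite mulr_suml; apply: ler_sum => l _.
by rewrite normrM ler_wpM2l// /S (bigD1 l)//= lerDl; apply: sumr_ge0.
Qed.

(* Visser's iteration: the scalar recursion x' = x + (y^2 - x^2) / 2 started at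
   0 increases to |y| when |y| <= 1. *)
Fixpoint visser_mx A n : 'M[R]_m :=
  if n is n'.+1 then visser_mx A n' +
    2^-1 *: (A *m A - visser_mx A n' *m visser_mx A n')
  else 0.

Fixpoint visser (y : R) n : R :=
  if n is n'.+1 then visser y n' + 2^-1 * (y ^+ 2 - visser y n' ^+ 2) else 0.

(** With b = |y|, one step gives b - x' = (1 - (b + x)/2)(b - x), and the factor lies between 0 and
    1 - b/2 as long as 0 <= x <= b <= 1. This rate degenerates to 1 at y = 0, a case that the
    convergence proof treats apart. *)
Lemma visser_bound y n : `|y| <= 1 ->
  0 <= visser y n <= `|y| /\
  `|y| - visser y n <= (1 - `|y| / 2) ^+ n.
Proof.
move=> y1; elim: n => /= [|n [/andP[x0 xy] xe]].
  by rewrite lexx normr_ge0 subr0 expr0.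
set x := visser y n in x0 xy xe *; rewrite -(real_normK (num_real y)).
set b := `|y| in y1 xy xe *.
split; first by nra.
rewrite [leRHS]exprS; have -> : b - (x + 2^-1 * (b ^+ 2 - x ^+ 2)) =
  (1 - (b + x) / 2) * (b - x) by field.
apply: ler_pM => //; lra.
Qed.

Lemma visser_cvg y : `|y| <= 1 -> visser y n @[n --> \oo] --> `|y|.
Proof.
move=> y1; have [->|y0] := eqVneq y 0.
  rewrite normr0; suff -> : visser 0 = cst 0 by exact: cvg_cst.
  by apply/funext; elim=> //= n ->; rewrite expr0n/= subr0 mulr0 addr0.
apply: (@squeeze_cvgr _ _ _ _ (fun n => `|y| - (1 - `|y| / 2) ^+ n) (fun=> `|y|)).
- near=> n; have [/andP[_ ->] h] := visser_bound n y1.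
  by rewrite andbT; move: h; rewrite !lerBlDr addrC.
- rewrite -[X in _ --> X]subr0; apply: cvgB; first exact: cvg_cst.
  apply: cvg_expr; have := y1; have : 0 < `|y| by rewrite normr_gt0.
  by move=> ? ?; rewrite ger0_norm; lra.
- exact: cvg_cst.
Unshelve. all: by end_near.
Qed.

Lemma visser_spectral (P : 'M[R]_m) L a n : P \in unitmx ->
  visser_mx (spectral_map P L (fun t => a * t)) n =
  spectral_map P L (fun t => visser (a * t) n).
Proof.
move=> uP; elim: n => /= [|n IHn].
  rewrite /spectral_map (_ : map_mx _ _ = 0) ?linear0 ?mulmx0 ?mul0mx//.
  by apply/rowP => j; rewrite !mxE.
rewrite IHn !spectral_mapM// -[- spectral_map _ _ _]scaleN1r.
rewrite !(spectral_mapZ, spectral_mapD).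
rewrite /spectral_map; congr (P *m diag_mx _ *m _).
by apply/rowP => k; rewrite !mxE mulN1r -!expr2.
Qed.

(** Dividing by [s] puts the eigenvalues in [-1, 1], and s |t/s| = |t| undoes it. The approximants
    are polynomials in the entries of A, free of any chosen eigendecomposition. *)
Lemma absmx_cvg A (s : R) i j : A = A^T -> 0 < s -> \sum_k \sum_l `|A k l| <= s ->
  s * visser_mx (s^-1 *: A) n i j @[n --> \oo] --> absmx A i j.
Proof.
move=> symA s0 As; have [P [L [uP AE ->]]] := absmx_spectral symA.
have sV_ge0 : 0 <= s^-1 by rewrite invr_ge0 ltW.
have Ls k : `|s^-1 * L 0 k| <= 1.
  rewrite normrM (ger0_norm sV_ge0) ler_pdivrMl// mulr1.
  by apply: (le_trans (spectral_map_eigen_le L k uP)); rewrite -AE.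
have spE phi : spectral_map P L phi i j =
    \sum_k P i k * phi (L 0 k) * invmx P k j.
  by rewrite /spectral_map mxE; apply: eq_bigr => k _; rewrite mul_mx_diag !mxE.
have E n : s * visser_mx (s^-1 *: A) n i j =
    \sum_k s * (P i k * visser (s^-1 * L 0 k) n * invmx P k j).
  by rewrite AE spectral_mapZ visser_spectral// spE mulr_sumr.
rewrite spE; under eq_cvg do rewrite E.
apply: cvg_big => [|k _]; first exact: add_continuous.
have -> : P i k * `|L 0 k| * invmx P k j =
    s * (P i k * `|s^-1 * L 0 k| * invmx P k j).
  by rewrite normrM (ger0_norm sV_ge0); field; rewrite gt_eqF.
apply: cvgMl_tmp; apply: cvgMr_tmp; apply: cvgMl_tmp.
exact: visser_cvg.
Qed.

End absolute_value.

(** * Measures and null sets *)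

Section null_sets.
Context d (X : measurableType d) (R : realType) (mu : {measure set X -> \bar R}).
Implicit Types (D N : set X).
Import HBNNSimple.

(** [f] may be nonmeasurable, so the integrals are compared as suprema over simple functions:
    cutting a simple function off on [N] keeps its integral and places it below the restriction of
    [f] to the smaller set. *)
Lemma ge0_integral_setD_null D N (f : X -> \bar R) :
  measurable D -> measurable N -> mu N = 0%E -> (forall x, 0 <= f x)%E ->
  (\int[mu]_(x in D) f x = \int[mu]_(x in D `\` N) f x)%E.
Proof.
move=> mD mN N0 f0; rewrite !ge0_integralE//.
apply/eqP; rewrite eq_le; apply/andP; split; apply: ge_ereal_sup => _ [h /= hf <-].
  rewrite -integralT_nnsfun (@ge0_negligible_integral _ _ _ _ _ N)//; last 2 first.
  - by apply/measurable_EFinP; exact: measurable_funTS.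
  - by move=> x _; rewrite lee_fin.
  rewrite integral_nnsfun; last exact: measurableD.
  have mNc : measurable (setT `\` N) by exact: measurableD.
  apply: ereal_sup_ubound; exists (proj_nnsfun h mNc); last by rewrite mrestrict.
  move=> x; have := hf x; rewrite -mrestrict !patchE.
  have [xN|xN] := boolP (x \in setT `\` N); last first.
    by move=> _; case: ifPn => // _; exact: f0.
  have [|xD] := boolP (x \in D).
    rewrite !inE => Dx; rewrite ifT// inE; split => //.
    by move: xN; rewrite inE => -[].
  by rewrite ifF//; apply/negbTE; apply: contra xD; rewrite !inE => -[].
apply: ereal_sup_ubound; exists h => //= x; apply: (le_trans (hf x)).
rewrite !patchE; case: ifPn => [|_]; first by rewrite inE => -[Dx _]; rewrite mem_set.
by case: ifPn.
Qed.

Lemma Rintegral_setD_null D N (f : X -> R) :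
  measurable D -> measurable N -> mu N = 0%E ->
  \int[mu]_(x in D) f x = \int[mu]_(x in D `\` N) f x.
Proof.
move=> mD mN N0; rewrite /Rintegral integralE [in RHS]integralE.
by rewrite -!(@ge0_integral_setD_null D N).
Qed.

End null_sets.

Section absmx_measurable.
Context d (X : measurableType d) (R : realType) (m : nat).
Variables (D : set X) (B : X -> 'M[R]_m) (C : 'I_m -> 'I_m -> R).
Hypotheses (mB : forall i j, measurable_fun D (fun x => B x i j))
  (symB : forall x, D x -> B x = (B x)^T)
  (leB : forall x i j, D x -> `|B x i j| <= C i j).

Lemma measurable_visser s n i j :
  measurable_fun D (fun x => visser_mx (s *: B x) n i j).
Proof.
elim: n i j => [|n IHn] i j /=; first by under eq_fun do rewrite mxE; exact: measurable_cst.
under eq_fun do rewrite !mxE.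
have mA k l : measurable_fun D (fun x => (s *: B x) k l).
  by under eq_fun do rewrite mxE; exact: measurable_funM.
apply: measurable_funD => //; apply: measurable_funM => //.
by apply: measurable_funB; apply: measurable_sum => k; exact: measurable_funM.
Qed.

Lemma absmx_sum_le x : D x -> \sum_k \sum_l `|B x k l| <= \sum_(k < m) \sum_(l < m) `|C k l|.
Proof.
move=> Dx; apply: ler_sum => k _; apply: ler_sum => l _.
by apply: (le_trans (leB _ _ Dx)); exact: ler_norm.
Qed.

Lemma measurable_absmx i j : measurable_fun D (fun x => absmx (B x) i j).
Proof.
(* One rescaling serves all points of [D]; the summand 1 keeps it positive when every bound is 0. *)
pose s := 1 + \sum_(k < m) \sum_(l < m) `|C k l|.
have s0 : 0 < s by rewrite ltr_pwDl// sumr_ge0// => k _; rewrite sumr_ge0.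
apply: (measurable_fun_cvg (h := fun n x => s * visser_mx (s^-1 *: B x) n i j)).
  by move=> n; apply: measurable_funM => //; exact: measurable_visser.
move=> x Dx; apply: absmx_cvg => //; first exact: symB.
by apply: (le_trans (absmx_sum_le Dx)); rewrite lerDr.
Qed.

End absmx_measurable.

(** * Lebesgue and surface measures of cubes, open sets and bounded sets *)

Section lebesgue_rV.
Context {R : realType}.

Lemma measurable_ball_rV n (a : 'rV[R]_n) r : measurable (ball a r).
Proof.
have [r0|r0] := ltP 0 r; last first.
  rewrite (_ : ball a r = set0)//; apply/seteqP; split => // x [].
  by rewrite ltNge r0.
rewrite (_ : ball a r =
    \bigcap_(k in [set` index_enum 'I_n])
      ((fun M : 'rV[R]_n => M ord0 k) @^-1` ball (a ord0 k) r)).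
  rewrite bigcap_seq; apply: bigsetI_measurable => k _.
  rewrite -[X in measurable X]setTI; apply: measurable_mx_entry => //.
  exact: measurable_ball.
apply/seteqP; split => [x [_ xa] k _ /=|x xa]; first exact: xa.
by split=> // i j; rewrite ord1; apply: xa; rewrite /= mem_index_enum.
Qed.

Lemma rV_cons0 n (u : 'rV[R]_n * measurableTypeR R) : rV_cons u ord0 ord0 = u.2.
Proof.
have -> : ord0 = lshift n (ord0 : 'I_1) by exact/val_inj.
by rewrite /rV_cons (@row_mxEl _ 1 1 n) mxE eqxx.
Qed.

Lemma rV_consS n (u : 'rV[R]_n * measurableTypeR R) k :
  rV_cons u ord0 (lift ord0 k) = u.1 ord0 k.
Proof.
have -> : lift ord0 k = rshift 1 k by exact/val_inj.
by rewrite /rV_cons (@row_mxEr _ 1 1 n).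
Qed.

(** The norm is the sup norm: a ball is a cube, and its first coordinate splits off as a factor of a
    product set. *)
Lemma lebesgue_rV_ball n (a : 'rV[R]_n) r : 0 < r ->
  lebesgue_rV R n (ball a r) = ((r *+ 2) ^+ n)%:E.
Proof.
move=> r0; elim: n a => [|n IHn] a.
  rewrite expr0 /= diracE mem_set//; split => // i [].
  by [].
pose a' : 'rV[R]_n := \row_k a ord0 (lift ord0 k).
rewrite /= /image_measure /pushforward.
have -> : rV_cons (n := n) @^-1` ball a r = ball a' r `*` ball (a ord0 ord0) r.
  apply/seteqP; split => -[x t] /=.
    move=> [_ h]; split; last by have := h ord0 ord0; rewrite rV_cons0.
    split=> // i j; rewrite ord1 mxE.
    by have := h ord0 (lift ord0 j); rewrite rV_consS.
  move=> [[_ h1] h2]; split=> // i j; rewrite ord1.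
  have [k ->|->] := unliftP ord0 j; last by rewrite rV_cons0.
  by rewrite rV_consS; have := h1 ord0 k; rewrite mxE.
rewrite product_measure1E ?IHn//.
- transitivity (((r *+ 2) ^+ n)%:E * (r *+ 2)%:E)%E.
    by congr (_ * _)%E; exact/lebesgue_measure_ball/ltW.
  by rewrite -EFinM exprSr.
- exact: measurable_ball_rV.
- exact: measurable_ball.
Qed.

End lebesgue_rV.

Section lebesgue_rV_finite.
Context {R : realType} {n : nat}.
Implicit Type D : set 'rV[R]_n.

(** The sigma-algebra is generated by the coordinates and not by the topology; an open set is
    recovered as the countable union of the balls [b i] inside it, with rational centres and radii
    1/(k + 1). *)
Lemma open_measurable_rV D : open D -> measurable D.
Proof.
move=> oD; pose b (i : 'rV[rat]_n * nat) : set 'rV[R]_n :=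
  ball (map_mx (@ratr R) i.1 : 'rV[R]_n) i.2.+1%:R^-1.
pose F i := if `[< b i `<=` D >] then b i else set0.
have -> : D = \bigcup_i F i.
  apply/seteqP; split=> [x Dx|x [i _]]; last first.
    by rewrite /F; case: asboolP => [sub|_] //; exact: sub.
  have /nbhs_ballP[e e0 xe] : nbhs x D by exact: open_nbhs_nbhs.
  have e20 : 0 < e / 2 by rewrite divr_gt0.
  have [k _ /(_ k (leqnn k)) /= ke] := near_infty_natSinv_lt (PosNum e20).
  have k0 : 0 < k.+1%:R^-1 :> R by rewrite invr_gt0.
  have /choice [q qx] j : exists q : rat, `|@ratr R q - x ord0 j| < k.+1%:R^-1.
    have /rat_in_itvoo[q] : x ord0 j - k.+1%:R^-1 < x ord0 j + k.+1%:R^-1.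
      by rewrite ltrBlDr -addrA ltrDl addr_gt0.
    by rewrite in_itv/= => h; exists q; rewrite ltr_distl.
  have xb : b (\row_j q j, k) x by split=> // i j; rewrite ord1 !mxE; exact: qx.
  exists (\row_j q j, k) => //; rewrite /F asboolT// => y yb; apply: xe; rewrite (splitr e).
  apply: (@ball_triangle _ _ (map_mx (@ratr R) (\row_j q j))).
    by apply: ball_sym; apply: le_ball xb; exact: ltW.
  by apply: le_ball yb; exact: ltW.
apply: countable_bigcupT_measurable => [|i]; first exact: countableP.
by rewrite /F; case: asboolP => // _; exact: measurable_ball_rV.
Qed.

Lemma closed_measurable_rV D : closed D -> measurable D.
Proof.
by rewrite -openC => /open_measurable_rV/measurableC; rewrite setCK.
Qed.

Lemma bounded_setP D : bounded_set D <-> exists M : R, forall x, D x -> `|x| <= M.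
Proof.
split=> [/pinfty_ex_gt0[M _ DM]|[M DM]]; first by exists M.
exists M; split; first exact: num_real.
by move=> M' MM' x Dx; apply: le_trans (ltW MM'); exact: DM.
Qed.

Lemma lebesgue_rV_bounded D : measurable D -> bounded_set D ->
  (lebesgue_rV R n D < +oo)%E.
Proof.
move=> mD /bounded_setP[M DM].
have M0 : 0 < `|M| + 1 by rewrite ltr_wpDl.
apply: (@le_lt_trans _ _ (lebesgue_rV R n (ball 0 (`|M| + 1)))).
  apply: le_measure; rewrite ?inE//; first exact: measurable_ball_rV.
  move=> x Dx; rewrite mx_norm_ball /ball_/= sub0r normrN.
  by rewrite (le_lt_trans (DM _ Dx))// (le_lt_trans (ler_norm M))// ltrDl.
by rewrite lebesgue_rV_ball// ltry.
Qed.

(** The area is the volume of a prism over [D], each point of which is a point of [D] plus a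
    multiple of [nu] with coefficient in [0, 1]; the prism is thus bounded. *)
Lemma hyperplane_area_bounded (nu : 'rV[R]_n) c D : measurable D -> bounded_set D ->
  (hyperplane_area nu c D < +oo)%E.
Proof.
move=> mD /bounded_setP[M DM].
rewrite /= /image_measure /pushforward /mrestr.
apply: lebesgue_rV_bounded.
  apply: measurableI; last exact: measurable_slab.
  rewrite -[X in measurable X]setTI; exact: measurable_hyperplane_proj.
apply/bounded_setP; exists (M + `|nu|) => x [/= Dx /andP[xc xc1]].
have -> : x = hyperplane_proj nu c x + (inner nu x - c) *: nu.
  by rewrite /hyperplane_proj subrK.
apply: (le_trans (ler_normD _ _)); apply: lerD; first exact: DM.
rewrite normrZ ler_piMl//; rewrite ger0_norm ?subr_ge0// lerBlDl//.
Qed.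

Lemma lebesgue_rV_open_gt0 D : open D -> D !=set0 -> (0 < lebesgue_rV R n D)%E.
Proof.
move=> oD [x Dx]; have /nbhs_ballP[e e0 xe] : nbhs x D by exact: open_nbhs_nbhs.
apply: (@lt_le_trans _ _ (lebesgue_rV R n (ball x e))).
  by rewrite lebesgue_rV_ball// lte_fin exprn_gt0// mulrn_wgt0.
apply: le_measure; rewrite ?inE//; first exact: measurable_ball_rV.
exact: open_measurable_rV.
Qed.

End lebesgue_rV_finite.

(** * Polynomial functions *)

Section polynomial_functions.
Context {R : realType} {d : nat}.
Local Notation pt := 'rV[R]_d.
Local Notation pol := (mpoly.mpoly d R).
Implicit Types (P Q : pol).

(** Constants and variables generate the ring, which suits properties stable under sums and products
    such as measurability, boundedness and differentiability. *)
Lemma mpoly_ind_ring (H : pol -> Prop) :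
  (forall c, H (mpoly.mpolyC d c)) ->
  (forall i, H (mpoly.mpolyX R (mpoly.mnm1 i))) ->
  (forall P Q, H P -> H Q -> H (P + Q)) ->
  (forall P Q, H P -> H Q -> H (P * Q)) ->
  forall P, H P.
Proof.
move=> HC HX HD HM P; rewrite (mpoly.mpolyE P).
have H1 : H 1 by rewrite -[1]mpoly.mpolyC1; exact: HC.
apply: (big_ind H) => [||m _]; [|exact: HD|]; first by rewrite -(mpoly.mpolyC0 d R); exact: HC.
rewrite -mpoly.mul_mpolyC; apply: (HM); first exact: HC.
rewrite mpoly.mpolyXE_id; apply: (big_ind H) => [||i _]; [exact: H1|exact: HM|].
by elim: (mpoly.fun_of_multinom m i) => [|k IHk]; rewrite ?expr0// exprS; exact: HM.
Qed.

Definition polyfun P : pt -> R := fun x => mpoly.meval (x 0) P.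

Lemma polyfunC c : polyfun (mpoly.mpolyC d c) = cst c.
Proof. by apply/funext => x; exact: mpoly.mevalC. Qed.
Lemma polyfunX i : polyfun (mpoly.mpolyX R (mpoly.mnm1 i)) = fun x : pt => x 0 i.
Proof. by apply/funext => x; exact: mpoly.mevalXU. Qed.
Lemma polyfunD P Q : polyfun (P + Q) = fun x => polyfun P x + polyfun Q x.
Proof. by apply/funext => x; exact: mpoly.mevalD. Qed.
Lemma polyfunM P Q : polyfun (P * Q) = fun x => polyfun P x * polyfun Q x.
Proof. by apply/funext => x; exact: mpoly.mevalM. Qed.

Lemma measurable_polyfun P : measurable_fun setT (polyfun P).
Proof.
elim/mpoly_ind_ring : P => [c|i|P Q HP HQ|P Q HP HQ].
- by rewrite polyfunC; exact: measurable_cst.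
- by rewrite polyfunX; exact: measurable_mx_entry.
- by rewrite polyfunD; exact: measurable_funD.
- by rewrite polyfunM; exact: measurable_funM.
Qed.

Lemma bounded_polyfun P (D : set pt) : bounded_set D ->
  exists C, forall x, D x -> `|polyfun P x| <= C.
Proof.
move=> /bounded_setP[M DM].
elim/mpoly_ind_ring : P => [c|i|P Q [C HP] [C' HQ]|P Q [C HP] [C' HQ]].
- by exists `|c| => x _; rewrite polyfunC.
- exists M => x /DM; apply: le_trans; rewrite polyfunX.
  rewrite [leRHS]mx_normrE.
  exact: (@le_bigmax _ _ _ _ (fun ij : 'I_1 * 'I_d => `|x ij.1 ij.2|) (0, i)).
- exists (C + C') => x Dx; rewrite polyfunD (le_trans (ler_normD _ _))//.
  by rewrite lerD ?HP ?HQ.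
- exists (C * C') => x Dx; rewrite polyfunM normrM.
  by rewrite ler_pM ?HP ?HQ.
Qed.

Lemma continuous_polyfun P : continuous (polyfun P).
Proof.
elim/mpoly_ind_ring : P => [c|i|P Q HP HQ|P Q HP HQ].
- by rewrite polyfunC; exact: cst_continuous.
- by rewrite polyfunX; exact: coord_continuous.
- by rewrite polyfunD => x; exact: (continuousD (HP x) (HQ x)).
- by rewrite polyfunM => x; exact: (continuousM (HP x) (HQ x)).
Qed.

Lemma is_derive_coord (x v : pt) i : is_derive x v (fun y : pt => y 0 i) (v 0 i).
Proof.
suff h : (fun h : R => h^-1 *: ((h *: v + x) 0 i - x 0 i)) @ 0^' --> v 0 i.
  by apply: DeriveDef; [apply/cvg_ex; exists (v 0 i)|exact: cvg_lim].
apply: cvg_near_cst; near=> h.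
rewrite !mxE addrK [LHS]mulKf//.
near: h; exact: nbhs_dnbhs_neq.
Unshelve. all: by end_near. Qed.

Lemma is_derive_polyfun P (x : pt) k :
  is_derive x (delta_mx 0 k : pt) (polyfun P) (polyfun (mpoly.mderiv k P) x).
Proof.
elim/mpoly_ind_ring : P => [c|i|P Q HP HQ|P Q HP HQ].
- by rewrite mpoly.mderivC polyfunC /polyfun mpoly.meval0; exact: is_derive_cst.
- rewrite polyfunX; apply: is_derive_eq; first exact: is_derive_coord.
  rewrite mpoly.mderivX /polyfun mpoly.mevalZ mpoly.mevalX mxE eqxx/=.
  rewrite mpoly.mnmE; case: eqP => [->|/eqP ik]; last first.
    by rewrite mul0r.
  rewrite mul1r big1// => j _.
  by rewrite mpoly.mnmBE subnn expr0.
- rewrite mpoly.mderivD !polyfunD; exact: is_deriveD.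
- rewrite mpoly.mderivM polyfunD !polyfunM.
  apply: (@is_derive_eq _ _ _ _ _ _ _ _ (is_deriveM HP HQ)).
  by rewrite addrC; congr (_ + _); exact: mulrC.
Qed.

Lemma partial_polyfun k P : partial k (polyfun P) = polyfun (mpoly.mderiv k P).
Proof. by apply/funext => x; exact: (@derive_val _ _ _ _ _ _ _ (is_derive_polyfun P x k)). Qed.

Lemma smooth_polyfun P : smooth (polyfun P).
Proof.
move=> n; elim: n P => [|n IHn] P /=; split=> //; try exact: continuous_polyfun.
move=> k; split; last by rewrite partial_polyfun.
by move=> x; apply: (@ex_derive _ _ _ _ _ _ _ (is_derive_polyfun P x k)).
Qed.

(** A field in [Wh] is polynomial only on the closure of its cell; this gives its derivatives at the
    points of the open cell. *)
Lemma partial_local k (f g : pt -> R) (D : set pt) x : open D -> D x ->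
  (forall y, D y -> f y = g y) -> partial k f x = partial k g x.
Proof.
move=> oD Dx fg; apply: near_eq_derive.
by apply: filterS (open_nbhs_nbhs (conj oD Dx)) => y; exact: fg.
Qed.

(* Restricted to a line, P is a univariate polynomial. *)
Lemma polyfun_line P (x v : pt) : exists q : {poly R},
  forall t, polyfun P (x + t *: v) = q.[t].
Proof.
elim/mpoly_ind_ring : P => [c|i|P Q [p HP] [q HQ]|P Q [p HP] [q HQ]].
- by exists c%:P => t; rewrite polyfunC hornerC.
- exists ((x 0 i)%:P + v 0 i *: 'X) => t.
  by rewrite polyfunX !mxE !hornerE mulrC.
- by exists (p + q) => t; rewrite polyfunD HP HQ hornerD.
- by exists (p * q) => t; rewrite polyfunM HP HQ hornerM.
Qed.

(** On the line from a point of [D] to x, the polynomial is univariate with more zeros near that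
    point than its degree allows. *)
Lemma polyfun_eq0 P (D : set pt) : open D -> D !=set0 ->
  (forall x, D x -> polyfun P x = 0) -> forall x, polyfun P x = 0.
Proof.
move=> oD [x0 Dx0] P0 x; have [q qE] := polyfun_line P x0 (x - x0).
suff q0 : q = 0 by have := qE 1; rewrite scale1r addrC subrK q0 horner0.
have /nbhs_ballP[e e0 De] : nbhs x0 D by exact: open_nbhs_nbhs.
(* For 0 <= t <= c the point x0 + t (x - x0) stays within [e] of [x0]; the summand 1 covers x =
   x0. *)
pose c := e / (1 + `|x - x0|).
have c0 : 0 < c by rewrite divr_gt0// ltr_pwDl.
pose s := [seq c / k.+2%:R | k <- iota 0 (size q)].
apply/eqP/negP => /negP q0.
suff : (size s < size q)%N by rewrite size_map size_iota ltnn.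
apply: max_poly_roots => //.
  apply/allP => _ /mapP[k _ ->]; rewrite /root -qE P0//; apply: De.
  rewrite mx_norm_ball /ball_/= opprD addNKr normrN normrZ.
  have k1 : 1 <= k.+2%:R :> R by rewrite ler1n.
  have k0 : 0 < k.+2%:R :> R by [].
  rewrite ger0_norm; last by apply: divr_ge0; exact: ltW.
  have cx : c * `|x - x0| < e.
    by rewrite /c mulrAC ltr_pdivrMr ?ltr_pwDl// ltr_pM2l// ltrDr.
  apply: le_lt_trans cx; rewrite ler_wpM2r// ler_pdivrMr// ler_peMr//; exact: ltW.
rewrite /s map_inj_uniq ?iota_uniq// => i j /(mulfI (lt0r_neq0 c0))/invr_inj/eqP.
by rewrite eqr_nat => /eqP[].
Qed.

End polynomial_functions.

(** * Galerkin systems and bounded measurable functions *)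

(** Fredholm alternative for a possibly singular matrix: membership in the row space is tested on
    the columns of the cokernel, which lie in the kernel of [M]. *)
Lemma row_solution (F : fieldType) n (M : 'M[F]_n) (b : 'rV[F]_n) :
  (forall v : 'cV[F]_n, M *m v = 0 -> b *m v = 0) -> exists c : 'rV[F]_n, c *m M = b.
Proof.
move=> ker; suff /submxP[c ->] : (b <= M)%MS by exists c.
rewrite submxE; apply/eqP/matrixP => i j; rewrite ord1 mxE.
have /ker : M *m col j (cokermx M) = 0 by rewrite colE mulmxA mulmx_coker mul0mx.
by move=> /matrixP/(_ 0 0); rewrite colE mulmxA -colE !mxE.
Qed.

(* If a(., v) vanishes on the span of the g i, then so does a(v, v). *)
Lemma galerkin (F : fieldType) (V : lmodType F) (I : finType) (g : I -> V)
    (a : V -> V -> F) (b : V -> F) :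
  (forall c u v w, a (c *: u + v) w = c * a u w + a v w) ->
  (forall c u v w, a w (c *: u + v) = c * a w u + a w v) ->
  (forall c u v, b (c *: u + v) = c * b u + b v) ->
  (forall u, a u u = 0 -> b u = 0) ->
  exists c : I -> F, forall i, a (\sum_j c j *: g j) (g i) = b (g i).
Proof.
move=> al ar bl ab.
have sumE (h : V -> F) (hl : forall c u v, h (c *: u + v) = c * h u + h v)
    (c : I -> F) (s : seq I) :
    h (\sum_(j <- s) c j *: g j) = \sum_(j <- s) c j * h (g j).
  elim: s => [|j s IHs]; last by rewrite !big_cons hl IHs.
  (* Linearity at c = -1 and u = v = 0 gives h 0 = 0. *)
  by rewrite !big_nil; have := hl (-1) 0 0; rewrite scaler0 addr0 mulN1r addNr.
pose M := \matrix_(i < #|I|, j < #|I|) a (g (enum_val i)) (g (enum_val j)).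
pose r := \row_(j < #|I|) b (g (enum_val j)).
have [c cE] : exists c : 'rV[F]_#|I|, c *m M = r.
  (* A kernel vector holds the coordinates of a test vector orthogonal to every generator; it is
     orthogonal to itself, and [ab] then yields the compatibility condition. *)
  apply: row_solution => v Mv0; pose w i := v (enum_rank i) 0.
  have aw i : a (g i) (\sum_j w j *: g j) = 0.
    rewrite (sumE (a (g i))); last by move=> *; exact: ar.
    have /matrixP/(_ (enum_rank i) 0) := Mv0; rewrite !mxE => Mi; rewrite -[RHS]Mi.
    rewrite (reindex (@enum_val _ I)) /=; last exact: onW_bij (enum_val_bij _).
    by apply: eq_bigr => j _; rewrite !mxE enum_rankK /w enum_valK mulrC.
  have /ab bw : a (\sum_j w j *: g j) (\sum_j w j *: g j) = 0.
    rewrite (sumE (a^~ _)); last by move=> *; exact: al.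
    by apply: big1 => i _; rewrite aw mulr0.
  apply/matrixP => i j; rewrite !ord1 !mxE -[RHS]bw (sumE b bl).
  rewrite [RHS](reindex (@enum_val _ I)) /=; last exact: onW_bij (enum_val_bij _).
  by apply: eq_bigr => k _; rewrite !mxE /w enum_valK mulrC.
exists (fun i => c 0 (enum_rank i)) => i.
rewrite (sumE (a^~ _)); last by move=> *; exact: al.
have /matrixP/(_ 0 (enum_rank i)) := cE; rewrite !mxE enum_rankK => <-.
rewrite (reindex (@enum_val _ I)) /=; last exact: onW_bij (enum_val_bij _).
by apply: eq_bigr => j _; rewrite !mxE enum_rankK enum_valK.
Qed.

Section bounded_measurable.
Context d (X : measurableType d) (R : realType).
Implicit Types (D : set X) (f g : X -> R) (mu : {measure set X -> \bar R}).

(** The bound holds at every point, exceptional null sets having been removed from [D]; sums,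
    products and [absmx] of symmetric matrices then preserve the class without a.e. bookkeeping. *)
Definition bounded_measurable D f :=
  measurable_fun D f /\ exists C, forall x, D x -> `|f x| <= C.

Lemma bm_cst D c : bounded_measurable D (cst c).
Proof. by split=> //; exists `|c|. Qed.

Lemma bmD D f g : bounded_measurable D f -> bounded_measurable D g ->
  bounded_measurable D (fun x => f x + g x).
Proof.
move=> [mf [C fC]] [mg [C' gC']]; split; first exact: measurable_funD.
by exists (C + C') => x Dx; rewrite (le_trans (ler_normD _ _))// lerD ?fC ?gC'.
Qed.

Lemma bmM D f g : bounded_measurable D f -> bounded_measurable D g ->
  bounded_measurable D (fun x => f x * g x).
Proof.
move=> [mf [C fC]] [mg [C' gC']]; split; first exact: measurable_funM.
by exists (C * C') => x Dx; rewrite normrM ler_pM ?fC ?gC'.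
Qed.

Lemma bmN D f : bounded_measurable D f -> bounded_measurable D (fun x => - f x).
Proof.
move=> [mf [C fC]]; split; first exact: measurableT_comp.
by exists C => x Dx; rewrite normrN fC.
Qed.

Lemma bm_sum D I (s : seq I) (P : pred I) (h : I -> X -> R) :
  (forall i, P i -> bounded_measurable D (h i)) ->
  bounded_measurable D (fun x => \sum_(i <- s | P i) h i x).
Proof.
move=> bh; elim: s => [|i s IHs]; first by under eq_fun do rewrite big_nil; exact: bm_cst.
under eq_fun do rewrite big_cons.
by case Pi: (P i) => //; apply: bmD => //; exact: bh.
Qed.

Definition rintegrable mu D f := mu.-integrable D (EFin \o f).

Lemma bm_rintegrable mu D f : measurable D -> (mu D < +oo)%E ->
  bounded_measurable D f -> rintegrable mu D f.
Proof.
move=> mD Doo [mf [C fC]]; apply: measurable_bounded_integrable => //.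
by exists C; split; [exact: num_real|move=> M CM x Dx; exact: le_trans (fC _ Dx) (ltW CM)].
Qed.

Lemma rintegrable_bmM mu D f g : measurable D ->
  rintegrable mu D f -> bounded_measurable D g ->
  rintegrable mu D (fun x => f x * g x).
Proof.
move=> mD fi [mg [C gC]]; apply: (@integrableMl _ _ _ mu D mD (EFin \o f) g) => //.
by exists C; split; [exact: num_real|move=> M CM x Dx; exact: le_trans (gC _ Dx) (ltW CM)].
Qed.

Lemma rintegrable_sum mu D I (s : seq I) (P : pred I) (h : I -> X -> R) :
  measurable D -> (forall i, P i -> rintegrable mu D (h i)) ->
  rintegrable mu D (fun x => \sum_(i <- s | P i) h i x).
Proof.
move=> mD ih; rewrite /rintegrable.
rewrite (_ : _ \o _ = fun x => (\sum_(i <- s | P i) (h i x)%:E)%E); last first.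
  by apply/funext => x /=; rewrite sumEFin.
by apply: (integrable_sum mD) => i Pi; exact: ih.
Qed.

Lemma Rintegral_sum mu D I (s : seq I) (P : pred I) (h : I -> X -> R) :
  measurable D -> (forall i, P i -> rintegrable mu D (h i)) ->
  \int[mu]_(x in D) (\sum_(i <- s | P i) h i x) =
  \sum_(i <- s | P i) \int[mu]_(x in D) h i x.
Proof.
move=> mD ih; elim: s => [|i s IHs].
  rewrite big_nil; under eq_Rintegral do rewrite big_nil.
  by rewrite Rintegral_cst// mul0r.
rewrite big_cons; under eq_Rintegral do rewrite big_cons.
case Pi: (P i) => //; rewrite RintegralD//; first by rewrite IHs.
  exact: ih.
exact: rintegrable_sum.
Qed.

Lemma Rintegral_linear mu D c f g : measurable D ->
  rintegrable mu D f -> rintegrable mu D g ->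
  \int[mu]_(x in D) (c * f x + g x) =
  c * \int[mu]_(x in D) f x + \int[mu]_(x in D) g x.
Proof.
move=> mD fi gi; rewrite RintegralD ?RintegralZl//.
have := integrableZl mD c fi; congr (_.-integrable _ _).
Qed.

Lemma Rintegral0 mu D : \int[mu]_(x in D) (0 : R) = 0.
Proof. by rewrite /Rintegral integral0_eq. Qed.

Lemma Rintegral_ge0_eq0 mu D f : measurable D -> (mu D < +oo)%E ->
  bounded_measurable D f -> (forall x, D x -> 0 <= f x) ->
  \int[mu]_(x in D) f x = 0 -> exists N, [/\ measurable N, mu N = 0%E &
    forall x, (D `\` N) x -> f x = 0].
Proof.
move=> mD Doo bf f0 If0.
have fi := bm_rintegrable mD Doo bf.
have : (\int[mu]_(x in D) `|(f x)%:E| = 0)%E.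
  rewrite -[RHS](congr1 EFin If0) /Rintegral fineK; last exact: integrable_fin_num.
  by apply: eq_integral => x; rewrite inE => Dx; rewrite gee0_abs// lee_fin f0.
have mf : measurable_fun D (EFin \o f) by apply/measurable_EFinP; exact: bf.1.
move=> /(ae_eq_integral_abs mu mD mf)[N [mN N0 DN]].
exists N; split=> // x [Dx Nx]; apply: contrapT => fx; apply: Nx; apply: DN => /=.
by move=> /(_ Dx) [].
Qed.

Lemma ae_set mu (Q : X -> Prop) : (\forall x \ae mu, Q x) ->
  exists N, [/\ measurable N, mu N = 0%E & forall x, ~ N x -> Q x].
Proof.
move=> [N [mN N0 QN]]; exists N; split=> // x Nx.
by apply: contrapT => nQ; apply: Nx; exact: QN.
Qed.

End bounded_measurable.

Section bounded_measurable_matrix.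
Context d (X : measurableType d) (R : realType).
Implicit Type D : set X.

Definition bounded_measurable_mx p q D (f : X -> 'M[R]_(p, q)) :=
  forall i j, bounded_measurable D (fun x => f x i j).

Lemma bmxD p q D (f g : X -> 'M[R]_(p, q)) :
  bounded_measurable_mx D f -> bounded_measurable_mx D g ->
  bounded_measurable_mx D (fun x => f x + g x).
Proof. by move=> bf bg i j; under eq_fun do rewrite mxE; exact: bmD. Qed.

Lemma bmxN p q D (f : X -> 'M[R]_(p, q)) :
  bounded_measurable_mx D f -> bounded_measurable_mx D (fun x => - f x).
Proof. by move=> bf i j; under eq_fun do rewrite mxE; exact: bmN. Qed.

Lemma bmxZ p q D c (f : X -> 'M[R]_(p, q)) :
  bounded_measurable_mx D f -> bounded_measurable_mx D (fun x => c *: f x).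
Proof.
by move=> bf i j; under eq_fun do rewrite mxE; apply: bmM => //; exact: bm_cst.
Qed.

Lemma bmx_sum p q D I (s : seq I) (P : pred I) (f : I -> X -> 'M[R]_(p, q)) :
  (forall i, P i -> bounded_measurable_mx D (f i)) ->
  bounded_measurable_mx D (fun x => \sum_(i <- s | P i) f i x).
Proof.
move=> bf i j; under eq_fun do rewrite summxE.
by apply: bm_sum => k Pk; exact: bf.
Qed.

Lemma bmx_mul p q r D (f : X -> 'M[R]_(p, q)) (g : X -> 'M[R]_(q, r)) :
  bounded_measurable_mx D f -> bounded_measurable_mx D g ->
  bounded_measurable_mx D (fun x => f x *m g x).
Proof.
move=> bf bg i j; under eq_fun do rewrite mxE.
by apply: bm_sum => k _; exact: bmM.
Qed.

Lemma bm_inner p q D (f g : X -> 'M[R]_(p, q)) :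
  bounded_measurable_mx D f -> bounded_measurable_mx D g ->
  bounded_measurable D (fun x => inner (f x) (g x)).
Proof. by move=> bf bg; do 2!apply: bm_sum => ? _; exact: bmM. Qed.

Lemma bmx_absmx m D (B : X -> 'M[R]_m) :
  (forall x, D x -> B x = (B x)^T) ->
  bounded_measurable_mx D B -> bounded_measurable_mx D (fun x => absmx (B x)).
Proof.
move=> symB bB.
have /choice[C' BC'] (ij : 'I_m * 'I_m) : exists C, forall x, D x -> `|B x ij.1 ij.2| <= C.
  exact: (bB _ _).2.
pose C i j := C' (i, j).
have BC x i j : D x -> `|B x i j| <= C i j by exact: (BC' (i, j)).
move=> i j; split.
  apply: (@measurable_absmx _ _ _ _ _ _ C) => // k l; exact: (bB k l).1.
exists (\sum_k \sum_l `|C k l|) => x Dx.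
apply: le_trans (absmx_entry_le _ _ (symB _ Dx)) _.
by apply: (absmx_sum_le (D := D)) => // y k l; exact: BC.
Qed.

End bounded_measurable_matrix.

(** * Measurability and finite measure of cells and mortars *)

Section mesh_facts.
Context {R : realType} {d : nat} {Omega : set 'rV[R]_d} (T : mesh Omega).
Implicit Types (K : 'I_(nelt T)) (f : face T) (e : mortar T).

Lemma open_cell K : open (cell K). Proof. exact: region_open. Qed.

Lemma measurable_cell K : measurable (cell K).
Proof. by apply: open_measurable_rV; exact: open_cell. Qed.

Lemma bounded_closure (D : set 'rV[R]_d) : bounded_set D -> bounded_set (closure D).
Proof.
move=> /bounded_setP[M DM]; apply/bounded_setP; exists (M + 1) => x Dx.
have [y [Dy]] := Dx _ (nbhsx_ballx x 1 ltr01).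
rewrite mx_norm_ball /ball_/= => xy.
rewrite -[x](subrK y) (le_trans (ler_normD _ _))// addrC lerD ?DM//.
exact: ltW.
Qed.

Lemma cell_finite K : (lebesgue_rV R d (cell K) < +oo)%E.
Proof.
by apply: lebesgue_rV_bounded; [exact: measurable_cell|exact: region_bounded].
Qed.

Lemma facet_closure f : facet f `<=` closure (cell (tag f)).
Proof.
move=> x fx; have : frontier (cell (tag f)) x.
  by rewrite /cell face_cover; exists (tagged f).
by case.
Qed.

Lemma mortar_facet e f : side e f -> mortar_set e `<=` facet f.
Proof.
case: e => [[f1 f2]|f1] /=; first by move=> /orP[/eqP->|/eqP->] x [].
by move=> /eqP-> x [].
Qed.

Lemma mortar_closure e f : side e f -> mortar_set e `<=` closure (cell (tag f)).
Proof. by move=> ef x /(mortar_facet ef)/facet_closure. Qed.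

Lemma measurable_facet f : measurable (facet f).
Proof. by apply: closed_measurable_rV; exact: face_closed. Qed.

Lemma measurable_mortar e : measurable (mortar_set e).
Proof.
case: e => [[f1 f2]|f] /=; apply: measurableI; try exact: measurable_facet.
apply: measurableD; first by apply: closed_measurable_rV; exact: closed_closure.
by apply: open_measurable_rV; exact: open_interior.
Qed.

Lemma mortar_side e : exists f, side e f.
Proof.
by case: e => [[f1 f2]|f]; [exists f1|exists f]; rewrite /= eqxx.
Qed.

Lemma mortar_bounded e : bounded_set (mortar_set e).
Proof.
have [f ef] := mortar_side e.
have /bounded_setP[M cM] : bounded_set (closure (cell (tag f))).
  by apply: bounded_closure; exact: region_bounded.
by apply/bounded_setP; exists M => x /(mortar_closure ef); exact: cM.
Qed.

Lemma mortar_finite e : (mortar_area e (mortar_set e) < +oo)%E.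
Proof.
have mM := measurable_mortar e; have bM := mortar_bounded e.
by case: e mM bM => [[f1 f2]|f] mM bM; exact: hyperplane_area_bounded.
Qed.

Lemma bounded_measurable_polyfun (D : set 'rV[R]_d) P : measurable D -> bounded_set D ->
  bounded_measurable D (polyfun P).
Proof.
move=> mD bD; split; first by apply: measurable_funTS; exact: measurable_polyfun.
exact: bounded_polyfun.
Qed.

End mesh_facts.

(** * The HDG bilinear form *)

Section inner_bilinear.
Context {R : realType}.

Lemma innerDl p q (u v w : 'M[R]_(p, q)) : inner (u + v) w = inner u w + inner v w.
Proof.
rewrite -big_split; apply: eq_bigr => i _; rewrite -big_split; apply: eq_bigr => j _.
by rewrite mxE mulrDl.
Qed.

Lemma innerZl p q c (u v : 'M[R]_(p, q)) : inner (c *: u) v = c * inner u v.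
Proof.
rewrite !mulr_sumr; apply: eq_bigr => i _; rewrite mulr_sumr; apply: eq_bigr => j _.
by rewrite mxE mulrA.
Qed.

Lemma innerDr p q (u v w : 'M[R]_(p, q)) : inner w (u + v) = inner w u + inner w v.
Proof. by rewrite innerC innerDl !(innerC w). Qed.

Lemma innerZr p q c (u v : 'M[R]_(p, q)) : inner u (c *: v) = c * inner u v.
Proof. by rewrite innerC innerZl innerC. Qed.

Lemma inner0r p q (u : 'M[R]_(p, q)) : inner u 0 = 0.
Proof. by rewrite -(scale0r 0) innerZr mul0r. Qed.

Lemma innerNl p q (u v : 'M[R]_(p, q)) : inner (- u) v = - inner u v.
Proof. by rewrite -scaleN1r innerZl mulN1r. Qed.

Lemma innerNr p q (u v : 'M[R]_(p, q)) : inner u (- v) = - inner u v.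
Proof. by rewrite innerC innerNl innerC. Qed.

Lemma inner_suml p q I (s : seq I) (P : pred I) (u : I -> 'M[R]_(p, q)) v :
  inner (\sum_(i <- s | P i) u i) v = \sum_(i <- s | P i) inner (u i) v.
Proof.
elim/big_rec2: _ => [|i x w _ <-]; last by rewrite innerDl.
by rewrite innerC inner0r.
Qed.

(** The products of components are isolated because they serve as scalar test functions in Green's
    formula. *)
Lemma inner_mulmxE p (M : 'M[R]_p) (v w : 'cV[R]_p) :
  inner (M *m v) w = \sum_i \sum_j M i j * (w i 0 * v j 0).
Proof.
apply: eq_bigr => i _; rewrite big_ord1 mxE mulr_suml; apply: eq_bigr => j _.
by rewrite mulrAC mulrA.
Qed.

Lemma inner_mulmx_sym p (M : 'M[R]_p) (v w : 'cV[R]_p) : M = M^T ->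
  inner (M *m v) w = inner (M *m w) v.
Proof. by move=> symM; rewrite innerC inner_mulmx -symM. Qed.

End inner_bilinear.

Section discrete_fields.
Context {R : realType} {d m : nat} {Omega : set 'rV[R]_d} {T : mesh Omega}.
Local Notation pt := 'rV[R]_d.
Local Notation dof := (('I_(nelt T) + mortar T) * 'I_m)%type.
Local Notation U := (dof -> mpoly.mpoly d R).
Implicit Types (u v w : U) (K : 'I_(nelt T)) (f : face T) (e : mortar T).

(** A pair (z, zh) is encoded by one family [u] of polynomials indexed by elements, mortar indices
    and components: a vector space on which the forms are bilinear. *)
Definition elt_field u K x : 'cV[R]_m := \col_i polyfun (u (inl K, i)) x.
Definition elt_partial k u K x : 'cV[R]_m :=
  \col_i polyfun (mpoly.mderiv k (u (inl K, i))) x.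
Definition mortar_field u e x : 'cV[R]_m := \col_i polyfun (u (inr e, i)) x.

Lemma polyfun_linear c (P Q : mpoly.mpoly d R) x :
  polyfun (c *: P + Q) x = c * polyfun P x + polyfun Q x.
Proof. by rewrite polyfunD /polyfun mpoly.mevalZ. Qed.

Lemma elt_field_linear c u v K x :
  elt_field (c *: u + v) K x = c *: elt_field u K x + elt_field v K x.
Proof. by apply/colP => i; rewrite !mxE polyfun_linear. Qed.

Lemma elt_partial_linear k c u v K x :
  elt_partial k (c *: u + v) K x = c *: elt_partial k u K x + elt_partial k v K x.
Proof.
by apply/colP => i; rewrite !mxE -polyfun_linear mpoly.mderivD mpoly.mderivZ.
Qed.

Lemma mortar_field_linear c u v e x :
  mortar_field (c *: u + v) e x = c *: mortar_field u e x + mortar_field v e x.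
Proof. by apply/colP => i; rewrite !mxE polyfun_linear. Qed.

Lemma partial_vec_elt_field k u K :
  partial_vec k (elt_field u K) = elt_partial k u K.
Proof.
apply/funext => x; apply/colP => i; rewrite !mxE -partial_polyfun.
by congr (partial k _ x); apply/funext => y; rewrite mxE.
Qed.

Lemma bmx_polyfun (D : set pt) (P : 'I_m -> mpoly.mpoly d R) :
  measurable D -> bounded_set D ->
  bounded_measurable_mx D (fun x => \col_i polyfun (P i) x : 'cV[R]_m).
Proof.
move=> mD bD i j; under eq_fun do rewrite mxE.
exact: bounded_measurable_polyfun.
Qed.

End discrete_fields.

Section hdg_forms.
Context {R : realType} {d m : nat} {Omega : set 'rV[R]_d} (T : mesh Omega).
Local Notation pt := 'rV[R]_d.
Local Notation dof := (('I_(nelt T) + mortar T) * 'I_m)%type.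
Local Notation U := (dof -> mpoly.mpoly d R).
Implicit Types (u v w : U) (K : 'I_(nelt T)) (f : face T) (e : mortar T).
Local Notation leb := (lebesgue_rV R d).

Variables (G : pt -> 'M[R]_m) (A : 'I_d -> pt -> 'M[R]_m) (divA : pt -> 'M[R]_m).
Variables (B : face T -> pt -> 'M[R]_m) (f0 gD : pt -> 'cV[R]_m) (mu0 : R).
Variables (N0 : set pt) (N : mortar T -> set pt).

(** Cells and mortars stripped of the exceptional null sets: the coefficient hypotheses hold at all
    their points, and integrals over them are the original ones. *)
Let C K := cell K `\` N0.
Let M e := mortar_set e `\` N e.

Hypotheses (mN0 : measurable N0) (N00 : leb N0 = 0%E).
Hypotheses (mN : forall e, is_mortar e -> measurable (N e))
  (N0e : forall e, is_mortar e -> mortar_area e (N e) = 0%E).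
Hypotheses (bmA : forall K k, bounded_measurable_mx (C K) (A k))
  (bmG : forall K, bounded_measurable_mx (C K) G)
  (bmdivA : forall K, bounded_measurable_mx (C K) divA)
  (symA : forall K x k, C K x -> A k x = (A k x)^T)
  (posG : forall K x, C K x -> psdmx (G x + (G x)^T + divA x - (2 * mu0)%:M)).
Hypotheses (mu0_gt0 : 0 < mu0).
Hypotheses (bmB : forall e f, is_mortar e -> side e f -> bounded_measurable_mx (M e) (B f))
  (symB : forall e f x, is_mortar e -> side e f -> M e x -> B f x = (B f x)^T)
  (kerB : forall e f x, is_mortar e -> side e f -> M e x ->
    forall v : 'cV[R]_m, B f x *m v = 0 -> v = 0)
  (oppB : forall f1 f2 x, is_mortar (inl (f1, f2)) -> M (inl (f1, f2)) x ->
    B f2 x = - B f1 x).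
Hypotheses (intf0 : forall K i, rintegrable leb (C K) (fun x => f0 x i 0))
  (intg : forall f i, is_mortar (inr f) -> rintegrable (mortar_area (inr f)) (M (inr f))
    (fun x => boundary_data B gD f x i 0)).
Hypothesis green : forall K (phi : pt -> R), smooth phi -> forall i j,
    \sum_k \int[lebesgue_rV R d]_(x in cell K) (A k x i j * partial k phi x)
    + \int[lebesgue_rV R d]_(x in cell K) (divA x i j * phi x)
    = boundary_integral K (fun _ f x => B f x i j * phi x).

Let mC K : measurable (C K).
Proof. by apply: measurableD => //; exact: measurable_cell. Qed.
Let mM e : is_mortar e -> measurable (M e).
Proof. by move=> he; apply: measurableD; [exact: measurable_mortar|exact: mN]. Qed.

Let finC K : (leb (C K) < +oo)%E.
Proof.
apply: le_lt_trans (cell_finite K); apply: le_measure; rewrite ?inE//; last exact: subDsetl.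
exact: measurable_cell.
Qed.

Let finM e : is_mortar e -> (mortar_area e (M e) < +oo)%E.
Proof.
move=> he; apply: le_lt_trans (mortar_finite e); apply: le_measure; rewrite ?inE.
- exact: mM.
- exact: measurable_mortar.
- exact: subDsetl.
Qed.

Let bC K : bounded_set (C K).
Proof.
have /bounded_setP[c hc] := region_bounded (elt K).
by apply/bounded_setP; exists c => x [/hc].
Qed.

Let bM e : bounded_set (M e).
Proof.
have /bounded_setP[c hc] := mortar_bounded e.
by apply/bounded_setP; exists c => x [/hc].
Qed.

Let intC K (F : pt -> R) : \int[leb]_(x in cell K) F x = \int[leb]_(x in C K) F x.
Proof. by rewrite (Rintegral_setD_null _ _ mN0 N00)//; exact: measurable_cell. Qed.

Let intM e (F : pt -> R) : is_mortar e ->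
  \int[mortar_area e]_(x in mortar_set e) F x = \int[mortar_area e]_(x in M e) F x.
Proof.
move=> he; rewrite (Rintegral_setD_null _ _ (mN he) (N0e he))//.
exact: measurable_mortar.
Qed.

Let bm_elt u K : bounded_measurable_mx (C K) (elt_field u K).
Proof. exact: bmx_polyfun. Qed.
Let bm_partial k u K : bounded_measurable_mx (C K) (elt_partial k u K).
Proof. exact: bmx_polyfun. Qed.
Let bm_eltM u K e : is_mortar e -> bounded_measurable_mx (M e) (elt_field u K).
Proof. by move=> he; apply: bmx_polyfun => //; exact: mM. Qed.
Let bm_mortar u e : is_mortar e -> bounded_measurable_mx (M e) (mortar_field u e).
Proof. by move=> he; apply: bmx_polyfun => //; exact: mM. Qed.
Let bm_absB e f : is_mortar e -> side e f ->
  bounded_measurable_mx (M e) (fun x => absmx (B f x)).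
Proof.
move=> he ef; apply: bmx_absmx; last exact: bmB.
by move=> x Mx; exact: symB Mx.
Qed.

Definition dflux u e f x : 'cV[R]_m := flux B (elt_field u) (mortar_field u) e f x.

Let bm_flux u e f : is_mortar e -> side e f ->
  bounded_measurable_mx (M e) (dflux u e f).
Proof.
move=> he ef; apply: bmxD; apply: bmx_mul; [exact: bmB|exact: bm_eltM|exact: bm_absB|].
by apply: bmxD; [exact: bm_eltM|apply: bmxN; exact: bm_mortar].
Qed.

Definition vol_density u v K x : R :=
  - (\sum_k inner (A k x *m elt_field u K x) (elt_partial k v K x)) +
  inner (G x *m elt_field u K x) (elt_field v K x).

Definition flux_density u v e f x : R := inner (dflux u e f x) (elt_field v (tag f) x).

(** The unknown also occurs on the right of (G), in the boundary term with A + |A|; it is moved to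
    the left here. *)
Definition skel_density u v e x : R :=
  inner (\sum_(f | side e f) dflux u e f x) (mortar_field v e x) -
  (if e is inr f then
    inner (2^-1 *: ((B f x + absmx (B f x)) *m mortar_field u e x)) (mortar_field v e x)
   else 0).

Let bm_vol u v K : bounded_measurable (C K) (vol_density u v K).
Proof.
apply: bmD; last by apply: bm_inner => //; exact: bmx_mul.
by apply: bmN; apply: bm_sum => k _; apply: bm_inner => //; exact: bmx_mul.
Qed.

Let bm_fluxd u v e f : is_mortar e -> side e f ->
  bounded_measurable (M e) (flux_density u v e f).
Proof. by move=> he ef; apply: bm_inner; [exact: bm_flux|exact: bm_eltM]. Qed.

Let bm_skel u v e : is_mortar e -> bounded_measurable (M e) (skel_density u v e).
Proof.
move=> he; apply: bmD.
  apply: bm_inner; last exact: bm_mortar.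
  by apply: bmx_sum => f; exact: bm_flux.
apply: bmN; case: e he => [ff|f] he; first exact: bm_cst.
have ef : side (inr f : mortar T) f by rewrite /= eqxx.
apply: bm_inner; last exact: bm_mortar.
apply: bmxZ; apply: bmx_mul; last exact: bm_mortar.
by apply: bmxD; [exact: bmB he ef|exact: bm_absB].
Qed.

Definition local_form u v : R :=
  \sum_K \int[leb]_(x in C K) vol_density u v K x +
  \sum_(e | is_mortar e) \sum_(f | side e f)
    \int[mortar_area e]_(x in M e) flux_density u v e f x.

Definition skeleton_form u v : R :=
  \sum_(e | is_mortar e) \int[mortar_area e]_(x in M e) skel_density u v e x.

Definition hdg_form u v : R := local_form u v - skeleton_form u v.

Definition local_load v : R :=
  \sum_K \int[leb]_(x in C K) inner (f0 x) (elt_field v K x).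

Definition skeleton_load v : R :=
  \sum_(f | is_mortar (inr f : mortar T))
    \int[mortar_area (inr f : mortar T)]_(x in M (inr f))
      inner (2^-1 *: ((B f x - absmx (B f x)) *m boundary_data B gD f x))
            (mortar_field v (inr f) x).

(** The data term of (G) has a minus sign, which the subtraction of (G) from (L) turns into a
    plus. *)
Definition hdg_load v : R := local_load v + skeleton_load v.

(** * Bilinearity of the form and linearity of the load *)

Lemma dflux_linear c u v e f x :
  dflux (c *: u + v) e f x = c *: dflux u e f x + dflux v e f x.
Proof.
rewrite /dflux /flux elt_field_linear mortar_field_linear.
move: (B f x) (absmx _) (elt_field u _ x) (mortar_field u e x) => P Q z zh.
move: (elt_field v _ x) (mortar_field v e x) => y yh.
rewrite opprD addrACA -scalerBr; move: (z - zh) (y - yh) => a b.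
by rewrite !mulmxDr -!scalemxAr scalerDr addrACA.
Qed.

Lemma vol_density_linearl c u v w K x : vol_density (c *: u + v) w K x =
  c * vol_density u w K x + vol_density v w K x.
Proof.
rewrite /vol_density elt_field_linear mulmxDr -scalemxAr innerDl innerZl.
under eq_bigr do rewrite mulmxDr -scalemxAr innerDl innerZl.
by rewrite big_split/= -mulr_sumr; ring.
Qed.

Lemma vol_density_linearr c u v w K x : vol_density w (c *: u + v) K x =
  c * vol_density w u K x + vol_density w v K x.
Proof.
rewrite /vol_density elt_field_linear innerDr innerZr.
under eq_bigr do rewrite elt_partial_linear innerDr innerZr.
by rewrite big_split/= -mulr_sumr; ring.
Qed.

Lemma flux_density_linearl c u v w e f x : flux_density (c *: u + v) w e f x =
  c * flux_density u w e f x + flux_density v w e f x.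
Proof. by rewrite /flux_density dflux_linear innerDl innerZl. Qed.

Lemma flux_density_linearr c u v w e f x : flux_density w (c *: u + v) e f x =
  c * flux_density w u e f x + flux_density w v e f x.
Proof. by rewrite /flux_density elt_field_linear innerDr innerZr. Qed.

Lemma skel_density_linearl c u v w e x : skel_density (c *: u + v) w e x =
  c * skel_density u w e x + skel_density v w e x.
Proof.
rewrite /skel_density; under eq_bigr do rewrite dflux_linear.
rewrite big_split/= -scaler_sumr innerDl innerZl mortar_field_linear.
case: e => [ff|f]; first by ring.
by rewrite mulmxDr -scalemxAr !scalerDr !innerDl !innerZl; ring.
Qed.

Lemma skel_density_linearr c u v w e x : skel_density w (c *: u + v) e x =
  c * skel_density w u e x + skel_density w v e x.
Proof.
rewrite /skel_density mortar_field_linear innerDr innerZr.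
case: e => [ff|f]; first by ring.
by rewrite innerDr innerZr; ring.
Qed.

Let int_vol u v K : rintegrable leb (C K) (vol_density u v K).
Proof. exact: bm_rintegrable. Qed.
Let int_flux u v e f : is_mortar e -> side e f ->
  rintegrable (mortar_area e) (M e) (flux_density u v e f).
Proof. by move=> he ef; apply: bm_rintegrable; [exact: mM|exact: finM|exact: bm_fluxd]. Qed.
Let int_skel u v e : is_mortar e ->
  rintegrable (mortar_area e) (M e) (skel_density u v e).
Proof. by move=> he; apply: bm_rintegrable; [exact: mM|exact: finM|exact: bm_skel]. Qed.

Lemma local_form_linearl c u v w :
  local_form (c *: u + v) w = c * local_form u w + local_form v w.
Proof.
rewrite /local_form mulrDr addrACA !mulr_sumr -!big_split; congr (_ + _).
  apply: eq_bigr => K _ /=; rewrite -Rintegral_linear//.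
  by apply: eq_Rintegral => x _; exact: vol_density_linearl.
apply: eq_bigr => e he; rewrite mulr_sumr -big_split; apply: eq_bigr => f ef /=.
rewrite -Rintegral_linear//; first by apply: eq_Rintegral => x _; exact: flux_density_linearl.
all: by [exact: mM|exact: int_flux].
Qed.

Lemma local_form_linearr c u v w :
  local_form w (c *: u + v) = c * local_form w u + local_form w v.
Proof.
rewrite /local_form mulrDr addrACA !mulr_sumr -!big_split; congr (_ + _).
  apply: eq_bigr => K _ /=; rewrite -Rintegral_linear//.
  by apply: eq_Rintegral => x _; exact: vol_density_linearr.
apply: eq_bigr => e he; rewrite mulr_sumr -big_split; apply: eq_bigr => f ef /=.
rewrite -Rintegral_linear//; first by apply: eq_Rintegral => x _; exact: flux_density_linearr.
all: by [exact: mM|exact: int_flux].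
Qed.

Lemma skeleton_form_linearl c u v w :
  skeleton_form (c *: u + v) w = c * skeleton_form u w + skeleton_form v w.
Proof.
rewrite /skeleton_form mulr_sumr -big_split; apply: eq_bigr => e he /=.
rewrite -Rintegral_linear//; first by apply: eq_Rintegral => x _; exact: skel_density_linearl.
all: by [exact: mM|exact: int_skel].
Qed.

Lemma skeleton_form_linearr c u v w :
  skeleton_form w (c *: u + v) = c * skeleton_form w u + skeleton_form w v.
Proof.
rewrite /skeleton_form mulr_sumr -big_split; apply: eq_bigr => e he /=.
rewrite -Rintegral_linear//; first by apply: eq_Rintegral => x _; exact: skel_density_linearr.
all: by [exact: mM|exact: int_skel].
Qed.

Lemma hdg_form_linearl c u v w : hdg_form (c *: u + v) w = c * hdg_form u w + hdg_form v w.
Proof.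
rewrite /hdg_form local_form_linearl skeleton_form_linearl.
move: (local_form u w) (local_form v w) (skeleton_form u w) (skeleton_form v w) => l l' s s'.
by ring.
Qed.

Lemma hdg_form_linearr c u v w : hdg_form w (c *: u + v) = c * hdg_form w u + hdg_form w v.
Proof.
rewrite /hdg_form local_form_linearr skeleton_form_linearr.
move: (local_form w u) (local_form w v) (skeleton_form w u) (skeleton_form w v) => l l' s s'.
by ring.
Qed.

Lemma rintegrable_inner mu (D : set pt) p q (g h : pt -> 'M[R]_(p, q)) : measurable D ->
  (forall i j, rintegrable mu D (fun x => g x i j)) -> bounded_measurable_mx D h ->
  rintegrable mu D (fun x => inner (g x) (h x)).
Proof.
move=> mD ig bh; apply: rintegrable_sum => // i _; apply: rintegrable_sum => // j _.
exact: rintegrable_bmM.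
Qed.

Let int_load v K : rintegrable leb (C K) (fun x => inner (f0 x) (elt_field v K x)).
Proof. by apply: rintegrable_inner => // i j; rewrite ord1. Qed.

Let int_skel_load v f : is_mortar (inr f : mortar T) ->
  rintegrable (mortar_area (inr f : mortar T)) (M (inr f))
    (fun x => inner (2^-1 *: ((B f x - absmx (B f x)) *m boundary_data B gD f x))
            (mortar_field v (inr f) x)).
Proof.
move=> he; have ef : side (inr f : mortar T) f by rewrite /= eqxx.
(* The data are only integrable, so the bounded matrix is moved to the test field. *)
rewrite (_ : (fun x => _) = (fun x => inner (boundary_data B gD f x)
    (2^-1 *: ((B f x - absmx (B f x))^T *m mortar_field v (inr f) x)))); last first.
  by apply/funext => x; rewrite innerZl innerZr inner_mulmx trmxK.
apply: rintegrable_inner; first exact: mM.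
  by move=> i j; rewrite ord1; exact: intg.
apply: bmxZ; apply: bmx_mul; last exact: bm_mortar.
move=> i j; under eq_fun do rewrite mxE.
apply: bmxD; [exact: (bmB he ef)|apply: bmxN; exact: bm_absB].
Qed.

Lemma hdg_load_linear c u v : hdg_load (c *: u + v) = c * hdg_load u + hdg_load v.
Proof.
rewrite /hdg_load /local_load /skeleton_load mulrDr addrACA !mulr_sumr -!big_split.
congr (_ + _); apply: eq_bigr.
  move=> K _ /=; rewrite -Rintegral_linear//.
  by apply: eq_Rintegral => x _; rewrite elt_field_linear innerDr innerZr.
move=> f he /=; rewrite -Rintegral_linear.
- by apply: eq_Rintegral => x _; rewrite mortar_field_linear innerDr innerZr.
- exact: mM.
- exact: int_skel_load.
- exact: int_skel_load.
Qed.

(** * Green's formula and the energy identity *)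

Lemma green_elt u K :
  \int[leb]_(x in C K) (2 * (\sum_k inner (A k x *m elt_field u K x) (elt_partial k u K x))
     + inner (divA x *m elt_field u K x) (elt_field u K x)) =
  \sum_(e | is_mortar e) \sum_(f | side e f && (tag f == K))
    \int[mortar_area e]_(x in M e)
      inner (B f x *m elt_field u (tag f) x) (elt_field u (tag f) x).
Proof.
pose P i j := u (inl K, i) * u (inl K, j).
have bmP (Q : mpoly.mpoly d R) : bounded_measurable (C K) (polyfun Q).
  exact: bounded_measurable_polyfun.
have bmAP k i j : bounded_measurable (C K) (fun x => A k x i j * partial k (polyfun (P i j)) x).
  by rewrite partial_polyfun; apply: bmM => //; exact: bmA.
have bmdP i j : bounded_measurable (C K) (fun x => divA x i j * polyfun (P i j) x).
  by apply: bmM => //; exact: bmdivA.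
pose F i j x := \sum_k A k x i j * partial k (polyfun (P i j)) x +
  divA x i j * polyfun (P i j) x.
have bmF i j : bounded_measurable (C K) (F i j) by apply: bmD => //; exact: bm_sum.
transitivity (\sum_i \sum_j \int[leb]_(x in C K) F i j x).
  under eq_bigr => i _.
    rewrite -Rintegral_sum//; last by move=> j _; exact: bm_rintegrable.
    over.
  rewrite -Rintegral_sum//; last first.
    by move=> i _; apply: bm_rintegrable => //; exact: bm_sum.
  apply: eq_Rintegral => x; rewrite inE => Cx.
  transitivity (\sum_i \sum_j \sum_k A k x i j * partial k (polyfun (P i j)) x +
      \sum_i \sum_j divA x i j * polyfun (P i j) x); last first.
    rewrite -big_split; apply: eq_bigr => i _.
    by rewrite -big_split.
  congr (_ + _); last first.
    rewrite inner_mulmxE; apply: eq_bigr => i _; apply: eq_bigr => j _.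
    by rewrite !mxE polyfunM.
  rewrite mulr_sumr.
  under [RHS]eq_bigr do rewrite exchange_big.
  rewrite [RHS]exchange_big; apply: eq_bigr => k _ /=.
  (* The product rule gives two terms for each k; by symmetry of A_k both equal A_k z . d_k z,
     whence the factor 2. *)
  rewrite mulr_natl mulr2n {2}(inner_mulmx_sym _ _ (symA _ Cx)) !inner_mulmxE -big_split.
  apply: eq_bigr => i _; rewrite -big_split; apply: eq_bigr => j _ /=.
  rewrite partial_polyfun mpoly.mderivM polyfunD !polyfunM !mxE.
  by ring.
transitivity (\sum_i \sum_j \sum_(e | is_mortar e) \sum_(f | side e f && (tag f == K))
    \int[mortar_area e]_(x in M e) (B f x i j * polyfun (P i j) x)).
  apply: eq_bigr => i _; apply: eq_bigr => j _.
  rewrite RintegralD//; [|by apply: bm_rintegrable => //; exact: bm_sum|exact: bm_rintegrable].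
  rewrite Rintegral_sum//; last by move=> k _; exact: bm_rintegrable.
  (* Green's formula is given on the whole cells and mortars, so the null set is put back before it
     is applied. *)
  rewrite -intC; under eq_bigr do rewrite -intC.
  rewrite green; last exact: smooth_polyfun.
  by apply: eq_bigr => e he; apply: eq_bigr => f _; rewrite intM.
under eq_bigr do rewrite exchange_big.
rewrite exchange_big; apply: eq_bigr => e he /=.
under eq_bigr do rewrite exchange_big.
rewrite exchange_big; apply: eq_bigr => f /andP[ef /eqP fK] /=.
have bmBP i j : bounded_measurable (M e) (fun x => B f x i j * polyfun (P i j) x).
  by apply: bmM; [exact: bmB|exact: bounded_measurable_polyfun (mM he) (bM e)].
under eq_bigr => i _.
  rewrite -Rintegral_sum; [over|exact: mM|].
  by move=> j _; apply: bm_rintegrable => //; [exact: mM|exact: finM].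
rewrite -Rintegral_sum; [|exact: mM|]; last first.
  by move=> i _; apply: bm_rintegrable; [exact: mM|exact: finM|exact: bm_sum].
apply: eq_Rintegral => x _; rewrite inner_mulmxE fK.
by apply: eq_bigr => i _; apply: eq_bigr => j _; rewrite !mxE polyfunM.
Qed.

Definition vol_energy u K x : R :=
  inner (G x *m elt_field u K x) (elt_field u K x) +
  2^-1 * inner (divA x *m elt_field u K x) (elt_field u K x).

Definition gap u e f x : 'cV[R]_m := elt_field u (tag f) x - mortar_field u e x.

Definition skel_energy u e x : R :=
  \sum_(f | side e f)
    inner (gap u e f x) ((absmx (B f x) + 2^-1 *: B f x) *m gap u e f x) +
  (if e is inr f then
    2^-1 * inner (mortar_field u e x) (absmx (B f x) *m mortar_field u e x) else 0).

(** The strict order of element indices in [is_mortar] makes the two faces distinct. *)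
Lemma side_inl f1 f2 (F : face T -> R) : is_mortar (inl (f1, f2) : mortar T) ->
  \sum_(f | side (inl (f1, f2) : mortar T) f) F f = F f1 + F f2.
Proof.
move=> /andP[f12 _]; rewrite (bigD1 f1)/= ?eqxx//; congr (_ + _).
rewrite (big_pred1 f2)// => f; have [->|ff1] := eqVneq f f1; last by rewrite andbT.
by rewrite /=; apply/esym/negbTE; apply: contraTneq f12 => ->; rewrite ltnn.
Qed.

Lemma side_inr f1 (F : face T -> R) :
  \sum_(f | side (inr f1 : mortar T) f) F f = F f1.
Proof. by rewrite (big_pred1 f1). Qed.

(** With z = g + h, the mixed terms P g . h cancel because [P] is symmetric. The subtracted half of
    P z . z is the share of a face in Green's formula. *)
Lemma flux_energy (P Q : 'M[R]_m) (z h : 'cV[R]_m) : P = P^T ->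
  inner (P *m z + Q *m (z - h)) z - inner (P *m z + Q *m (z - h)) h
    - 2^-1 * inner (P *m z) z =
  inner (z - h) ((Q + 2^-1 *: P) *m (z - h)) - 2^-1 * inner (P *m h) h.
Proof.
move=> symP; have [g ->] : exists g, z = g + h by exists (z - h); rewrite subrK.
rewrite addrK (innerC g) !mulmxDr mulmxDl -scalemxAl !(innerDl, innerDr, innerZl).
by rewrite (inner_mulmx_sym g h symP); field.
Qed.

Lemma skel_energyE u e x : is_mortar e -> M e x ->
  \sum_(f | side e f) flux_density u u e f x - skel_density u u e x -
  2^-1 * (\sum_(f | side e f) inner (B f x *m elt_field u (tag f) x) (elt_field u (tag f) x))
  = skel_energy u e x.
Proof.
move=> he Mx; rewrite /skel_density inner_suml opprD opprK addrA mulr_sumr.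
rewrite -sumrB addrAC -sumrB.
under eq_bigr => f ef do rewrite (flux_energy _ _ _ (symB he ef Mx)).
rewrite sumrB -addrA; congr (_ + _); rewrite -mulr_sumr.
case: e he Mx => [[f1 f2]|f] he Mx.
  by rewrite side_inl// (oppB he Mx) mulNmx innerNl subrr mulr0 oppr0 addr0.
(* On a boundary mortar the remaining -1/2 A zh . zh meets the term 1/2 (A + |A|) zh . zh of (G) and
   leaves 1/2 |A| zh . zh. *)
by rewrite side_inr innerZl mulmxDl innerDl (innerC _ (_ *m _)) mulrDr addrA addNr add0r.
Qed.

Let bm_energy u K : bounded_measurable (C K) (vol_energy u K).
Proof.
apply: bmD; first by apply: bm_inner => //; exact: bmx_mul.
by apply: bmM; [exact: bm_cst|apply: bm_inner => //; exact: bmx_mul].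
Qed.

Let bm_skel_energy u e : is_mortar e -> bounded_measurable (M e) (skel_energy u e).
Proof.
move=> he; apply: bmD.
  apply: bm_sum => f ef.
  have bg : bounded_measurable_mx (M e) (gap u e f).
    by apply: bmxD; [exact: bm_eltM|apply: bmxN; exact: bm_mortar].
  apply: bm_inner => //; apply: bmx_mul => //.
  by apply: bmxD; [exact: bm_absB|apply: bmxZ; exact: bmB].
case: e he => [ff|f] he; first exact: bm_cst.
have ef : side (inr f : mortar T) f by rewrite /= eqxx.
apply: bmM; first exact: bm_cst.
by apply: bm_inner; [exact: bm_mortar|apply: bmx_mul; [exact: bm_absB|exact: bm_mortar]].
Qed.

Lemma hdg_form_energy u : hdg_form u u =
  \sum_K \int[leb]_(x in C K) vol_energy u K x +
  \sum_(e | is_mortar e) \int[mortar_area e]_(x in M e) skel_energy u e x.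
Proof.
pose I e f := \int[mortar_area e]_(x in M e)
  inner (B f x *m elt_field u (tag f) x) (elt_field u (tag f) x).
have bmI e f : is_mortar e -> side e f -> bounded_measurable (M e)
    (fun x => inner (B f x *m elt_field u (tag f) x) (elt_field u (tag f) x)).
  by move=> he ef; apply: bm_inner; [apply: bmx_mul; [exact: bmB|]|]; exact: bm_eltM.
have volE : \sum_K \int[leb]_(x in C K) vol_density u u K x =
    \sum_K \int[leb]_(x in C K) vol_energy u K x -
    2^-1 * (\sum_(e | is_mortar e) \sum_(f | side e f) I e f).
  (* Each face of a mortar belongs to exactly one element, so the element boundaries regroup mortar
     by mortar. *)
  have -> : \sum_(e | is_mortar e) \sum_(f | side e f) I e f =
      \sum_K \sum_(e | is_mortar e) \sum_(f | side e f && (tag f == K)) I e f.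
    rewrite exchange_big; apply: eq_bigr => e _.
    exact: (partition_big (fun f => tag f) xpredT).
  rewrite mulr_sumr -sumrB; apply: eq_bigr => K _; rewrite -green_elt.
  have bmc : bounded_measurable (C K) (fun x =>
      2 * (\sum_k inner (A k x *m elt_field u K x) (elt_partial k u K x))
      + inner (divA x *m elt_field u K x) (elt_field u K x)).
    apply: bmD; last by apply: bm_inner => //; exact: bmx_mul.
    apply: bmM; first exact: bm_cst.
    by apply: bm_sum => k _; apply: bm_inner => //; exact: bmx_mul.
  rewrite addrC -mulNr -Rintegral_linear//; [|exact: bm_rintegrable|exact: bm_rintegrable].
  by apply: eq_Rintegral => x _; rewrite /vol_density /vol_energy; field.
rewrite /hdg_form /local_form volE -!addrA; congr (_ + _).
have skelE e : is_mortar e -> \int[mortar_area e]_(x in M e) skel_energy u e x =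
    \sum_(f | side e f) \int[mortar_area e]_(x in M e) flux_density u u e f x -
    \int[mortar_area e]_(x in M e) skel_density u u e x -
    2^-1 * (\sum_(f | side e f) I e f).
  move=> he; have mMe := mM he; have finMe := finM he.
  have bmf : bounded_measurable (M e) (fun x => \sum_(f | side e f) flux_density u u e f x).
    by apply: bm_sum => f; exact: bm_fluxd.
  have bms := bm_skel u u he.
  have bmi : bounded_measurable (M e) (fun x => \sum_(f | side e f)
      inner (B f x *m elt_field u (tag f) x) (elt_field u (tag f) x)).
    by apply: bm_sum => f; exact: bmI.
  rewrite -Rintegral_sum//; last by move=> f; exact: int_flux.
  rewrite -Rintegral_sum//; last by move=> f ef; apply: bm_rintegrable => //; exact: bmI.
  rewrite -RintegralB//; [|exact: bm_rintegrable|exact: bm_rintegrable].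
  rewrite addrC -mulNr -Rintegral_linear//; last 2 first.
  - exact: bm_rintegrable.
  - by apply: bm_rintegrable => //; apply: bmD => //; exact: bmN.
  apply: eq_Rintegral => x; rewrite inE => Mx.
  by rewrite -skel_energyE// addrC mulNr.
under [RHS]eq_bigr => e he do rewrite skelE//.
by rewrite !sumrB -mulr_sumr addrC.
Qed.

(** G and its transpose have the same quadratic form, so positivity (A.4) at z is twice this
    inequality. *)
Lemma vol_energy_ge u K x : C K x ->
  mu0 * inner (elt_field u K x) (elt_field u K x) <= vol_energy u K x.
Proof.
move=> /posG/(_ (elt_field u K x)); rewrite /vol_energy.
move: (elt_field u K x) => z.
rewrite !mulmxDl mulNmx mul_scalar_mx !innerDr innerNr innerZr (inner_mulmx (G x)^T) trmxK.
rewrite (innerC z (G x *m z)) (innerC z (divA x *m z)).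
by move: (inner _ _) (inner (divA x *m z) z) (inner z z) => a b c; lra.
Qed.

Lemma skel_energy_ge u e x : is_mortar e -> M e x ->
  0 <= skel_energy u e x /\
  (skel_energy u e x = 0 -> forall f, side e f -> gap u e f x = 0).
Proof.
move=> he Mx.
have gap_ge0 f : side e f -> 0 <= inner (gap u e f x)
    ((absmx (B f x) + 2^-1 *: B f x) *m gap u e f x).
  by move=> ef; apply: absmx_half_psd; exact: symB Mx.
have bd_ge0 : 0 <= (if e is inr f then
    2^-1 * inner (mortar_field u e x) (absmx (B f x) *m mortar_field u e x) else 0).
  case: e he Mx {gap_ge0} => [//|f] he Mx; apply: mulr_ge0; first by rewrite invr_ge0.
  by apply: absmx_psd; apply: symB Mx => //; rewrite /= eqxx.
have sum_ge0 : 0 <= \sum_(f | side e f) inner (gap u e f x)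
    ((absmx (B f x) + 2^-1 *: B f x) *m gap u e f x) by exact: sumr_ge0.
split; first exact: addr_ge0.
move=> /eqP; rewrite paddr_eq0// psumr_eq0// => /andP[/allP g0 _] f ef.
have := g0 f (mem_index_enum _); rewrite ef => /eqP.
apply: absmx_half_definite; first exact: symB Mx.
exact: kerB Mx.
Qed.

(** z vanishes off a null set, and polynomial rigidity makes it vanish everywhere; zh equals the
    trace of z off a null set of each mortar. The second conclusion is weaker because a polynomial
    with zero trace on a flat set can be nonzero elsewhere. *)
Lemma hdg_form_eq0 u : hdg_form u u = 0 ->
  (forall K i x, polyfun (u (inl K, i)) x = 0) /\
  forall e, is_mortar e -> exists N', [/\ measurable N', mortar_area e N' = 0%E &
    forall x, mortar_set e x -> ~ N' x -> mortar_field u e x = 0].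
Proof.
have vol_ge0 K x : C K x -> 0 <= vol_energy u K x.
  move=> Cx; apply: le_trans (vol_energy_ge u Cx).
  by apply: mulr_ge0; [exact: ltW|exact: inner_ge0].
have skel_ge0 e x : is_mortar e -> M e x -> 0 <= skel_energy u e x.
  by move=> he Mx; have [] := skel_energy_ge u he Mx.
have Ivol_ge0 K : true -> 0 <= \int[leb]_(x in C K) vol_energy u K x.
  by move=> _; apply: Rintegral_ge0; exact: vol_ge0.
have Iskel_ge0 e : is_mortar e -> 0 <= \int[mortar_area e]_(x in M e) skel_energy u e x.
  by move=> he; apply: Rintegral_ge0 => x; exact: skel_ge0.
rewrite hdg_form_energy => /eqP; rewrite paddr_eq0; [|exact: sumr_ge0|exact: sumr_ge0].
rewrite !psumr_eq0// => /andP[/allP vol0 /allP skel0].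
have u0 K i x : polyfun (u (inl K, i)) x = 0.
  have /eqP/(Rintegral_ge0_eq0 (@mC K) (@finC K) (bm_energy u K) (@vol_ge0 K)) :=
    vol0 K (mem_index_enum _).
  move=> [N1 [mN1 N10 hN1]].
  have z0 y : cell K y -> ~ N0 y -> ~ N1 y -> polyfun (u (inl K, i)) y = 0.
    move=> Ky N0y N1y; have Cy : C K y by [].
    have : elt_field u K y = 0.
      apply: inner_eq0; apply/eqP; rewrite eq_le inner_ge0 andbT.
      by rewrite -(pmulr_rle0 _ mu0_gt0) -(hN1 y)//; exact: vol_energy_ge.
    by move=> /colP/(_ i); rewrite !mxE.
  apply: (@polyfun_eq0 _ _ (u (inl K, i)) (cell K)
    (@open_cell _ _ _ _ K) (region_neq0 (elt K))) => y Ky.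
  apply: contrapT => uy.
  (* The part of the cell where the polynomial is nonzero is open and contained in a null set, hence
     empty. *)
  pose D := cell K `&` (polyfun (u (inl K, i)) @^-1` [set t | t != 0]).
  have oD : open D.
    apply: openI; first exact: open_cell.
    apply: open_comp; first by move=> ? _; exact: continuous_polyfun.
    exact: open_neq.
  have : (0 < leb D)%E.
    by apply: lebesgue_rV_open_gt0 => //; exists y; split=> //; apply/eqP.
  suff -> : leb D = 0%E by rewrite ltxx.
  apply: (@subset_measure0 _ _ _ leb D (N0 `|` N1)).
  - exact: open_measurable_rV.
  - exact: measurableU.
  - move=> t [Kt /eqP ut]; apply: contrapT => /not_orP[N0t N1t].
    by apply: ut; exact: z0.
  - exact: null_set_setU.
split=> // e he.
have /= := skel0 e (mem_index_enum _); rewrite he => /eqP.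
move=> /(Rintegral_ge0_eq0 (mM he) (finM he) (bm_skel_energy u he)).
case=> [x|N1 [mN1 N10 hN1]]; first exact: skel_ge0.
exists (N e `|` N1); split; first by apply: measurableU => //; exact: mN.
  by apply: null_set_setU => //; [exact: mN|exact: N0e].
move=> x ex /not_orP[Nx N1x]; have [f ef] := mortar_side e.
have [_] := skel_energy_ge u he (conj ex Nx : M e x).
move=> /(_ (hN1 x (conj (conj ex Nx) N1x)) f ef)/eqP.
rewrite subr_eq0 => /eqP <-; apply/colP => i; rewrite !mxE.
exact: u0.
Qed.

(** This is the compatibility condition of [galerkin]: the load depends only on the element fields
    and on the mortar fields up to null sets. *)
Lemma hdg_load_eq0 u : hdg_form u u = 0 -> hdg_load u = 0.
Proof.
move=> /hdg_form_eq0[z0 h0]; rewrite /hdg_load /local_load /skeleton_load.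
rewrite big1 ?add0r => [|K _]; last first.
  rewrite -[RHS](Rintegral0 leb (C K)); apply: eq_Rintegral => x _.
  by rewrite (_ : elt_field u K x = 0) ?inner0r//; apply/colP => i; rewrite !mxE.
apply: big1 => f he; have [N' [mN' N'0 hN']] := h0 _ he.
rewrite (Rintegral_setD_null _ (mM he) mN' N'0).
rewrite -[RHS](Rintegral0 (mortar_area (inr f)) (M (inr f) `\` N')).
apply: eq_Rintegral => x; rewrite inE => -[[ex _] N'x].
by rewrite hN' ?inner0r.
Qed.

(** * From fields to families of polynomials *)

(** Agreement is asked only on closed cells and on mortars, where [Wh] and [What] prescribe the
    fields. *)
Definition represents (z : 'I_(nelt T) -> pt -> 'cV[R]_m)
    (zh : mortar T -> pt -> 'cV[R]_m) u :=
  (forall K x, closure (cell K) x -> z K x = elt_field u K x) /\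
  (forall e x, is_mortar e -> mortar_set e x -> zh e x = mortar_field u e x).

Lemma represents_fields u : represents (elt_field u) (mortar_field u) u.
Proof. by []. Qed.

Let cellW K x : x \in cell K -> closure (cell K) x.
Proof. by rewrite inE => Kx; exact: subset_closure. Qed.

Lemma represents_flux z zh u e f x : represents z zh u -> is_mortar e -> side e f ->
  mortar_set e x -> flux B z zh e f x = dflux u e f x.
Proof.
move=> [zu hu] he ef ex; rewrite /dflux /flux zu ?hu//.
exact: mortar_closure ef _ ex.
Qed.

Lemma local_formE z zh u (w : 'I_(nelt T) -> pt -> 'cV[R]_m) wh v :
  represents z zh u -> represents w wh v ->
  - (\sum_K \sum_k \int[leb]_(x in cell K) inner (A k x *m z K x) (partial_vec k (w K) x))
  + \sum_K \int[leb]_(x in cell K) inner (G x *m z K x) (w K x)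
  + \sum_K boundary_integral K (fun e f x => inner (flux B z zh e f x) (w K x))
  = local_form u v.
Proof.
move=> zu [wv _]; rewrite /local_form; congr (_ + _).
  rewrite addrC -sumrB; apply: eq_bigr => K _.
  have bmk k : bounded_measurable (C K)
      (fun x => inner (A k x *m elt_field u K x) (elt_partial k v K x)).
    by apply: bm_inner => //; exact: bmx_mul.
  have -> : \sum_k \int[leb]_(x in cell K) inner (A k x *m z K x) (partial_vec k (w K) x) =
      \int[leb]_(x in C K) \sum_k inner (A k x *m elt_field u K x) (elt_partial k v K x).
    rewrite Rintegral_sum//; last by move=> k _; exact: bm_rintegrable.
    apply: eq_bigr => k _; rewrite -intC; apply: eq_Rintegral => x Kx.
    rewrite (zu.1 _ _ (cellW Kx)); congr inner; rewrite -partial_vec_elt_field.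
    apply/colP => i; rewrite !mxE; apply: (partial_local k (@open_cell _ _ _ _ K)).
      by rewrite inE in Kx.
    by move=> y Ky; rewrite wv//; exact: subset_closure.
  have -> : \int[leb]_(x in cell K) inner (G x *m z K x) (w K x) =
      \int[leb]_(x in C K) inner (G x *m elt_field u K x) (elt_field v K x).
    by rewrite -intC; apply: eq_Rintegral => x Kx; have cKx := cellW Kx; rewrite zu.1// wv.
  rewrite -RintegralB//; first by apply: eq_Rintegral => x _; rewrite addrC.
    by apply: bm_rintegrable => //; apply: bm_inner => //; exact: bmx_mul.
  by apply: bm_rintegrable => //; exact: bm_sum.
rewrite /boundary_integral exchange_big; apply: eq_bigr => e he /=.
rewrite [RHS](partition_big (fun f => tag f) xpredT)//=; apply: eq_bigr => K _.
apply: eq_bigr => f /andP[ef /eqP fK]; rewrite -intM//.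
apply: eq_Rintegral => x; rewrite inE => ex.
rewrite /flux_density (represents_flux zu he ef ex) wv -?fK//.
exact: mortar_closure ef _ ex.
Qed.

Let sum_mortar (F : mortar T -> R) : \sum_(e | is_mortar e) F e =
  \sum_(ff | is_mortar (inl ff : mortar T)) F (inl ff) +
  \sum_(f | is_mortar (inr f : mortar T)) F (inr f).
Proof. exact: big_sumType. Qed.

Lemma skeleton_formE z zh u (w : 'I_(nelt T) -> pt -> 'cV[R]_m) wh v :
  represents z zh u -> represents w wh v ->
  \sum_(e | is_mortar e)
    \int[mortar_area e]_(x in mortar_set e) inner (\sum_(f | side e f) flux B z zh e f x) (wh e x)
  = skeleton_form u v + \sum_(f : face T | is_mortar (inr f))
        \int[mortar_area (inr f : mortar T)]_(x in mortar_set (inr f : mortar T))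
          inner (2^-1 *: ((B f x + absmx (B f x)) *m zh (inr f) x))
                (wh (inr f) x).
Proof.
(* [bd] extends the boundary term by zero to interior mortars, so that it merges with the skeleton
   integrals. *)
move=> zu [_ whv]; pose bd e x : R := if e is inr f then
    inner (2^-1 *: ((B f x + absmx (B f x)) *m mortar_field u e x)) (mortar_field v e x)
   else 0.
have bm_bd e : is_mortar e -> bounded_measurable (M e) (bd e).
  case: e => [ff|f] he; first exact: bm_cst.
  have ef : side (inr f : mortar T) f by rewrite /= eqxx.
  apply: bm_inner; last exact: bm_mortar.
  apply: bmxZ; apply: bmx_mul; last exact: bm_mortar.
  by apply: bmxD; [exact: bmB he ef|exact: bm_absB].
have -> : \sum_(f : face T | is_mortar (inr f))
        \int[mortar_area (inr f : mortar T)]_(x in mortar_set (inr f : mortar T))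
          inner (2^-1 *: ((B f x + absmx (B f x)) *m zh (inr f) x))
                (wh (inr f) x) =
    \sum_(e | is_mortar e) \int[mortar_area e]_(x in M e) bd e x.
  rewrite sum_mortar [X in _ = X + _]big1 ?add0r; last first.
    by move=> ff _; exact: (Rintegral0 (mortar_area (inl ff)) (M (inl ff))).
  apply: eq_bigr => f he; rewrite -intM//; apply: eq_Rintegral => x; rewrite inE => ex.
  by rewrite /bd zu.2 ?whv.
rewrite /skeleton_form -big_split; apply: eq_bigr => e he /=.
rewrite -RintegralD; [|exact: mM|exact: int_skel|]; last first.
  by apply: bm_rintegrable; [exact: mM|exact: finM|exact: bm_bd].
rewrite intM//; apply: eq_Rintegral => x; rewrite inE => -[ex _].
rewrite /skel_density /bd subrK whv//; congr inner.
by apply: eq_bigr => f ef; exact: represents_flux.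
Qed.

Lemma local_loadE (w : 'I_(nelt T) -> pt -> 'cV[R]_m) wh v : represents w wh v ->
  \sum_K \int[leb]_(x in cell K) inner (f0 x) (w K x) = local_load v.
Proof.
move=> [wv _]; apply: eq_bigr => K _; rewrite -intC; apply: eq_Rintegral => x Kx.
by rewrite wv//; exact: cellW.
Qed.

Lemma skeleton_loadE (w : 'I_(nelt T) -> pt -> 'cV[R]_m) wh v : represents w wh v ->
  \sum_(f : face T | is_mortar (inr f))
         \int[mortar_area (inr f : mortar T)]_(x in mortar_set (inr f : mortar T))
           inner (2^-1 *: ((B f x - absmx (B f x)) *m boundary_data B gD f x))
                 (wh (inr f) x) = skeleton_load v.
Proof.
move=> [_ whv]; apply: eq_bigr => f he; rewrite -intM//.
by apply: eq_Rintegral => x; rewrite inE => ex; rewrite whv.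
Qed.

(** * Degree bounds, equivalence with (L)-(G), existence and uniqueness *)

Variable p : 'I_(nelt T) -> nat.

Definition dof_degree (j : dof) : nat :=
  match j.1 with inl K => p K | inr e => mdegree p e end.

Definition discrete_space u := forall j, (mpoly.msize (u j) <= (dof_degree j).+1)%N.

Lemma discrete_space_Wh u : discrete_space u -> Wh p (elt_field u).
Proof. by move=> su K i; exists (u (inl K, i)) => [|x _]; [exact: su|rewrite mxE]. Qed.

Lemma discrete_space_What u : discrete_space u -> What p (mortar_field u).
Proof. by move=> su e _ i; exists (u (inr e, i)) => [|x _]; [exact: su|rewrite mxE]. Qed.

Lemma discrete_space_linear c u v : discrete_space u -> discrete_space v ->
  discrete_space (c *: u + v).
Proof.
move=> su sv j; apply: (leq_trans (mpoly.msizeD_le _ _)).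
by rewrite geq_max sv andbT (leq_trans (mpoly.msizeZ_le _ _)).
Qed.

Lemma representable z zh : Wh p z -> What p zh ->
  exists2 u, discrete_space u & represents z zh u.
Proof.
move=> Wz Wzh.
have /choice[u hu] (j : dof) : exists P, (mpoly.msize P <= (dof_degree j).+1)%N /\
    match j.1 with
    | inl K => forall x, closure (cell K) x -> z K x j.2 0 = polyfun P x
    | inr e => is_mortar e -> forall x, mortar_set e x -> zh e x j.2 0 = polyfun P x
    end.
  case: j => -[K|e] i; first by have [P dP zP] := Wz K i; exists P.
  have [he|he] := boolP (is_mortar e); last first.
    (* [What] prescribes nothing at an index that is not a mortar; the zero polynomial respects the
       degree bound. *)
    by exists 0; rewrite mpoly.msize0; split=> // he'; rewrite he' in he.
  by have [P dP zP] := Wzh e he i; exists P; split=> //= _ x; exact: zP.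
exists u; first by move=> j; have [] := hu j.
split=> [K|e] x.
  by move=> Kx; apply/colP => i; rewrite mxE; have [_] := hu (inl K, i); apply.
by move=> he ex; apply/colP => i; rewrite mxE; have [_] := hu (inr e, i); apply.
Qed.

(** The test pairs (w, 0) and (0, wh), which split the single equation for [hdg_form] back into (L)
    and (G). *)
Definition elt_part v : U := fun j => if j.1 is inl _ then v j else 0.
Definition mortar_part v : U := fun j => if j.1 is inr _ then v j else 0.

Lemma hdg_form_elt_part u v : hdg_form u (elt_part v) = local_form u v.
Proof.
rewrite /hdg_form [skeleton_form _ _](_ : _ = 0) ?subr0//.
apply: big1 => e _; rewrite -[RHS](Rintegral0 (mortar_area e) (M e)).
apply: eq_Rintegral => x _; rewrite /skel_density.
have -> : mortar_field (elt_part v) e x = 0.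
  by apply/colP => i; rewrite !mxE /polyfun mpoly.meval0.
by rewrite inner0r; case: e => [ff|f]; rewrite ?inner0r subr0.
Qed.

Lemma hdg_form_mortar_part u v : hdg_form u (mortar_part v) = - skeleton_form u v.
Proof.
rewrite /hdg_form [local_form _ _](_ : _ = 0) ?sub0r//.
have z0 K x : elt_field (mortar_part v) K x = 0.
  by apply/colP => i; rewrite !mxE /polyfun mpoly.meval0.
have d0 k K x : elt_partial k (mortar_part v) K x = 0.
  by apply/colP => i; rewrite !mxE mpoly.mderiv0 /polyfun mpoly.meval0.
rewrite /local_form big1 ?add0r.
  apply: big1 => e _; apply: big1 => f _.
  rewrite -[RHS](Rintegral0 (mortar_area e) (M e)); apply: eq_Rintegral => x _.
  by rewrite /flux_density z0 inner0r.
move=> K _; rewrite -[RHS](Rintegral0 leb (C K)); apply: eq_Rintegral => x _.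
by rewrite /vol_density z0 inner0r addr0 big1 ?oppr0// => k _; rewrite d0 inner0r.
Qed.

Lemma hdg_load_elt_part v : hdg_load (elt_part v) = local_load v.
Proof.
rewrite /hdg_load [skeleton_load _](_ : _ = 0) ?addr0//.
apply: big1 => f _; rewrite -[RHS](Rintegral0 (mortar_area (inr f)) (M (inr f))).
apply: eq_Rintegral => x _.
have -> : mortar_field (elt_part v) (inr f) x = 0.
  by apply/colP => i; rewrite !mxE /polyfun mpoly.meval0.
by rewrite inner0r.
Qed.

Lemma hdg_load_mortar_part v : hdg_load (mortar_part v) = skeleton_load v.
Proof.
rewrite /hdg_load [local_load _](_ : _ = 0) ?add0r//.
apply: big1 => K _; rewrite -[RHS](Rintegral0 leb (C K)).
apply: eq_Rintegral => x _.
have -> : elt_field (mortar_part v) K x = 0.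
  by apply/colP => i; rewrite !mxE /polyfun mpoly.meval0.
by rewrite inner0r.
Qed.

Lemma discrete_space_elt_part v : discrete_space v -> discrete_space (elt_part v).
Proof.
move=> sv [[K|e] i]; rewrite /elt_part /=; last by rewrite mpoly.msize0.
exact: sv.
Qed.

Lemma discrete_space_mortar_part v : discrete_space v -> discrete_space (mortar_part v).
Proof.
move=> sv [[K|e] i]; rewrite /mortar_part /=; first by rewrite mpoly.msize0.
exact: sv.
Qed.

Lemma hdg_solutionP z zh u : discrete_space u -> represents z zh u ->
  hdg_solution p G A B f0 gD z zh <->
  [/\ Wh p z, What p zh & forall v, discrete_space v -> hdg_form u v = hdg_load v].
Proof.
move=> su zu; split=> [[Wz Wzh L Gl]|[Wz Wzh E]]; split=> //.
- move=> v sv; rewrite /hdg_form /hdg_load.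
  have := L _ (discrete_space_Wh sv).
  rewrite (local_formE zu (represents_fields v)) (local_loadE (represents_fields v)) => ->.
  have := Gl _ (discrete_space_What sv).
  rewrite (skeleton_formE zu (represents_fields v)) (skeleton_loadE (represents_fields v)).
  by move=> /addIr ->; rewrite opprK.
(* The solution's own [zh] only completes w to a pair; [elt_part] discards it afterwards. *)
- move=> w Ww; have [v sv wv] := representable Ww Wzh.
  rewrite (local_formE zu wv) (local_loadE wv).
  by rewrite -hdg_form_elt_part -hdg_load_elt_part E//; exact: discrete_space_elt_part.
- move=> wh Wwh; have [v sv wv] := representable Wz Wwh.
  rewrite (skeleton_formE zu wv) (skeleton_loadE wv); congr (_ + _).
  rewrite -hdg_load_mortar_part -E; last exact: discrete_space_mortar_part.
  by rewrite hdg_form_mortar_part opprK.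
Qed.

Lemma hdg_load0 : hdg_load 0 = 0.
Proof. by have := hdg_load_linear (-1) 0 0; rewrite scaler0 addr0 mulN1r addNr. Qed.

Lemma discrete_solution : exists2 u, discrete_space u &
  forall v, discrete_space v -> hdg_form u v = hdg_load v.
Proof.
(* A common strict bound on all degrees, so that one finite type of exponents serves every
   component. *)
pose D := (\max_j (dof_degree j).+1)%N.
(* The monomial n placed at index k, replaced by 0 when its degree exceeds the bound at k; every
   generator is then admissible. *)
pose gen1 (k : dof) (n : mpoly.bmultinom d D) : U := fun j =>
  if (j == k) && (mpoly.mdeg n < (dof_degree j).+1)%N then mpoly.mpolyX R n else 0.
pose g (i : dof * mpoly.bmultinom d D) : U := gen1 i.1 i.2.
have sg i : discrete_space (g i).
  by move=> j; rewrite /g /gen1; case: ifPn => [/andP[_]|_]; rewrite ?mpoly.msizeX ?mpoly.msize0.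
have ssum (c : _ -> R) : discrete_space (\sum_i c i *: g i).
  apply: (big_ind discrete_space) => [j|v w sv sw|i _].
  - by rewrite mpoly.msize0.
  - by rewrite -[v]scale1r; exact: discrete_space_linear.
  - rewrite -[_ *: _]addr0; apply: discrete_space_linear => // j.
    by rewrite mpoly.msize0.
have gen v : discrete_space v -> exists c, v = \sum_i c i *: g i.
  move=> sv; exists (fun i : dof * mpoly.bmultinom d D => mpoly.mcoeff i.2 (v i.1)).
  apply/funext => j.
  rewrite fct_sumE.
  have jD : (mpoly.msize (v j) <= D)%N.
    by apply: (leq_trans (sv j)); exact: (@leq_bigmax _ (fun j => (dof_degree j).+1) j).
  rewrite {1}(mpoly.mpolywE jD).
  rewrite -(pair_bigA _ (fun k (n : mpoly.bmultinom d D) =>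
    mpoly.mcoeff n (v k) *: gen1 k n j))/=.
  rewrite (bigD1 j)//= [X in _ = _ + X]big1 ?addr0; last first.
    move=> k kj; apply: big1 => n _.
    by rewrite /gen1 eq_sym (negbTE kj) scaler0.
  apply: eq_bigr => n _; rewrite /gen1 eqxx/=; case: ifPn => //.
  (* A monomial above the degree bound has coefficient 0 in [v], so its zero generator loses
     nothing. *)
  rewrite -leqNgt => nj; rewrite [mpoly.mcoeff _ _](_ : _ = 0) ?scale0r ?scaler0//.
  apply: mpoly.memN_msupp_eq0; apply: mpoly.msize_mdeg_ge.
  exact: (leq_trans (sv j)).
have [c hc] := galerkin g hdg_form_linearl hdg_form_linearr hdg_load_linear hdg_load_eq0.
exists (\sum_i c i *: g i) => // v /gen[a ->].
apply: (big_ind (fun w => hdg_form _ w = hdg_load w)) => [|v1 v2 h1 h2|i _].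
- by have := hdg_form_linearr (-1) 0 0; rewrite hdg_load0 => h;
    have := h (\sum_i c i *: g i); rewrite scaler0 addr0 mulN1r addNr.
- by rewrite -[v1]scale1r hdg_form_linearr hdg_load_linear h1 h2.
- rewrite -[_ *: _]addr0 hdg_form_linearr hdg_load_linear hc; congr (_ + _).
  by have := hdg_form_linearr (-1) 0 0; rewrite hdg_load0 => h;
    have := h (\sum_i c i *: g i); rewrite scaler0 addr0 mulN1r addNr.
Qed.

Lemma hdg_well_posed : exists zh : mortar T -> pt -> 'cV[R]_m,
  (exists z, hdg_solution p G A B f0 gD z zh) /\
  forall zh', (exists z', hdg_solution p G A B f0 gD z' zh') ->
    forall e, is_mortar e ->
      \forall x \ae mortar_area e, mortar_set e x -> zh' e x = zh e x.
Proof.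
have [u su Eu] := discrete_solution; exists (mortar_field u); split.
  exists (elt_field u); apply/(hdg_solutionP su (represents_fields u)); split=> //.
    exact: discrete_space_Wh.
  exact: discrete_space_What.
move=> zh' [z' sol'] e he.
have [Wz' Wzh' _ _] := sol'; have [u' su' zu'] := representable Wz' Wzh'.
have /(hdg_solutionP su' zu')[_ _ Eu'] := sol'.
(* The representing families may differ, but their difference has zero energy. *)
pose w := (-1) *: u + u'.
have sw : discrete_space w by exact: discrete_space_linear.
have /hdg_form_eq0[_ /(_ e he)[N' [mN' N'0 hN']]] : hdg_form w w = 0.
  by rewrite hdg_form_linearl Eu// Eu'// mulN1r addNr.
exists N'; split=> // x /= nx; apply: contrapT => N'x; apply: nx => ex.
have := hN' x ex N'x; rewrite mortar_field_linear scaleN1r addrC => /eqP.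
by rewrite subr_eq0 => /eqP <-; rewrite zu'.2.
Qed.

End hdg_forms.

(** * Well-posedness *)

Section almost_everywhere.
Context {R : realType} {d : nat}.
Local Notation pt := 'rV[R]_d.

Lemma Linf_ae_bound (I : finType) (mu : {measure set pt -> \bar R}) (D : set pt)
    (F : I -> pt -> R) : (forall i, Linf mu D (F i)) ->
  exists C : I -> R, \forall x \ae mu, forall i, D x -> `|F i x| <= C i.
Proof.
move=> FL; have /choice[C hC] i : exists C : R, \forall x \ae mu, D x -> `|F i x| <= C.
  exact: (FL i).2.
by exists C; apply: filter_forall.
Qed.

Lemma Linf_bounded_measurable (mu : {measure set pt -> \bar R}) (D E : set pt) f c :
  measurable D -> E `<=` D -> Linf mu D f -> (forall x, E x -> `|f x| <= c) ->
  bounded_measurable E f.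
Proof.
by move=> mD ED [mf _] fc; split; [exact: measurable_funS ED mf|exists c].
Qed.

(** |f| is dominated by 1 + f^2, integrable on a set of finite measure. *)
Lemma L2_rintegrable (mu : {measure set pt -> \bar R}) (D E : set pt) f :
  measurable D -> measurable E -> E `<=` D -> (mu D < +oo)%E -> L2 mu D f ->
  rintegrable mu E f.
Proof.
move=> mD mE ED Doo [mf If]; apply: (integrableS mD mE ED).
have I1 : mu.-integrable D (fun x => (1 + f x ^+ 2)%:E).
  have := integrableD mD (bm_rintegrable mD Doo (bm_cst D 1)) If.
  by congr (_.-integrable _ _).
apply: le_integrable I1 => //; first exact/measurable_EFinP.
move=> x Dx /=; rewrite lee_fin [leRHS]ger0_norm ?addr_ge0 ?sqr_ge0//.
by have := sqr_ge0 (`|f x| - 1); rewrite -(real_normK (num_real (f x))); nra.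
Qed.

End almost_everywhere.

Theorem theorem3p4 (R : realType) (d m : nat) (hd : (0 < d)%N)
  (Omega : set 'rV[R]_d) (hOmega : lipschitz_domain Omega)
  (T : mesh Omega) (p : 'I_(nelt T) -> nat)
  (G : 'rV[R]_d -> 'M[R]_m) (A : 'I_d -> 'rV[R]_d -> 'M[R]_m)
  (divA : 'rV[R]_d -> 'M[R]_m)
  (bA : face T -> 'I_d -> 'rV[R]_d -> 'M[R]_m)
  (f : 'rV[R]_d -> 'cV[R]_m) (gD : 'rV[R]_d -> 'cV[R]_m) (mu0 : R)
  (hf : forall i, L2 (lebesgue_rV R d) Omega (fun x => f x i 0))
  (hg : forall fc : face T, is_mortar (inr fc) -> forall i,
    L2 (mortar_area (inr fc)) (mortar_set (inr fc))
      (fun x => boundary_data (normal_mx bA) gD fc x i 0))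
  (A1 : forall i j, Linf (lebesgue_rV R d) Omega (fun x => G x i j))
  (A2 : forall k i j, Linf (lebesgue_rV R d) Omega (fun x => A k x i j))
  (A2_div : weak_divergence Omega A divA)
  (A2_div_Linf : forall i j,
    Linf (lebesgue_rV R d) Omega (fun x => divA x i j))
  (A3 : forall k, \forall x \ae lebesgue_rV R d,
    Omega x -> A k x = (A k x)^T)
  (A4_pos : 0 < mu0)
  (A4 : \forall x \ae lebesgue_rV R d,
    Omega x -> psdmx (G x + (G x)^T + divA x - (2 * mu0)%:M))
  (hbA : boundary_values A divA bA)
  (hbA_sym : forall (e : mortar T) (fc : face T), is_mortar e -> side e fc ->
    \forall x \ae mortar_area e,
      mortar_set e x -> normal_mx bA fc x = (normal_mx bA fc x)^T)
  (hbA_cont : forall f1 f2 : face T, is_mortar (inl (f1, f2)) ->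
    \forall x \ae mortar_area (inl (f1, f2)),
      mortar_set (inl (f1, f2)) x -> normal_mx bA f2 x = - normal_mx bA f1 x)
  (hM : forall fc : face T, is_mortar (inr fc) ->
    \forall x \ae mortar_area (inr fc),
      mortar_set (inr fc) x -> psdmx (absmx (normal_mx bA fc x)))
  (hnull : forall (e : mortar T) (fc : face T), is_mortar e -> side e fc ->
    \forall x \ae mortar_area e, mortar_set e x ->
      forall v : 'cV[R]_m, normal_mx bA fc x *m v = 0 -> v = 0) :
  exists zh : mortar T -> 'rV[R]_d -> 'cV[R]_m,
    (exists z, hdg_solution p G A (normal_mx bA) f gD z zh) /\
    forall zh', (exists z', hdg_solution p G A (normal_mx bA) f gD z' zh') ->
      forall e, is_mortar e ->
        \forall x \ae mortar_area e, mortar_set e x -> zh' e x = zh e x.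
Proof.
have [oO _ _ bO _] := hOmega.
have mO : measurable Omega by exact: open_measurable_rV.
have finO : (lebesgue_rV R d Omega < +oo)%E by exact: lebesgue_rV_bounded.
pose AI := ('I_d * ('I_m * 'I_m))%type; pose MI := ('I_m * 'I_m)%type.
have [cA hcA] := Linf_ae_bound (fun i : AI => A2 i.1 i.2.1 i.2.2).
have [cG hcG] := Linf_ae_bound (fun i : MI => A1 i.1 i.2).
have [cD hcD] := Linf_ae_bound (fun i : MI => A2_div_Linf i.1 i.2).
have hsym : \forall x \ae lebesgue_rV R d, forall k, Omega x -> A k x = (A k x)^T.
  exact: filter_forall.
(* All volume hypotheses are gathered into a single measurable null set. *)
have [N0 [mN0 N00 hN0]] := ae_set
  (filterI (filterI hcA (filterI hcG hcD)) (filterI hsym A4)).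
have CO (K : 'I_(nelt T)) x : (cell K `\` N0) x -> Omega x /\ ~ N0 x.
  by move=> [Kx N0x]; split=> //; exact: (@elt_sub _ _ _ T K).
have CsubO (K : 'I_(nelt T)) : cell K `\` N0 `<=` Omega by move=> x /CO[].
(* One null set per mortar serves all its sides and all pointwise hypotheses; the premise
   [is_mortar e] makes the condition vacuous elsewhere, so that choice can range over all
   indices. *)
pose good e (Ne : set 'rV[R]_d) (c : face T -> AI -> R) := is_mortar e ->
  [/\ measurable Ne, mortar_area e Ne = 0%E &
  forall x, (mortar_set e `\` Ne) x ->
    [/\ forall fc, side e fc -> forall i, `|bA fc i.1 x i.2.1 i.2.2| <= c fc i,
        forall fc, side e fc -> normal_mx bA fc x = (normal_mx bA fc x)^T,
        forall fc, side e fc -> forall v : 'cV[R]_m, normal_mx bA fc x *m v = 0 -> v = 0 &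
        forall f1 f2, e = inl (f1, f2) -> normal_mx bA f2 x = - normal_mx bA f1 x]].
have /choice[Nc hNc] e : exists Nc, good e Nc.1 Nc.2.
  have [he|he] := boolP (is_mortar e); last first.
    by exists (set0, fun=> fun=> 0) => he'; rewrite he' in he.
  have ae_side (Q : face T -> 'rV[R]_d -> Prop) :
      (forall fc, side e fc -> \forall x \ae mortar_area e, mortar_set e x -> Q fc x) ->
      \forall x \ae mortar_area e, forall fc, mortar_set e x -> side e fc -> Q fc x.
    move=> hQ; apply: filter_forall => fc; have [ef|ef] := boolP (side e fc).
      by apply: filterS (hQ fc ef) => x Qx ex _; exact: Qx.
    by apply: nearW => x _.
  have /choice[c hc] fc : exists c : AI -> R, side e fc ->
      \forall x \ae mortar_area e, mortar_set e x ->
        forall i, `|bA fc i.1 x i.2.1 i.2.2| <= c i.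
    have [ef|ef] := boolP (side e fc); last by exists (fun=> 0).
    have [c hc] := Linf_ae_bound (fun i : AI => hbA.1 e fc he ef i.1 i.2.1 i.2.2).
    by exists c => _; apply: filterS hc => x hx ex i; exact: hx.
  have hopp : \forall x \ae mortar_area e, mortar_set e x ->
      forall f1 f2, e = inl (f1, f2) -> normal_mx bA f2 x = - normal_mx bA f1 x.
    case: e he {hc ae_side c} => [[f1 f2]|f1] he; last by apply: nearW => x _ f2 f3.
    by apply: filterS (hbA_cont _ _ he) => x hx ex _ _ [<- <-]; exact: hx.
  have [Ne [mNe Ne0 hNe]] := ae_set (filterI
    (filterI (ae_side _ hc) (ae_side _ (hbA_sym e ^~ he)))
    (filterI (ae_side _ (hnull e ^~ he)) hopp)).
  exists (Ne, c) => _; split=> // x [ex Nx]; have [[h1 h2] [h3 h4]] := hNe x Nx.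
  split; [move=> fc|move=> fc|move=> fc|]; [exact: h1|exact: h2|exact: h3|exact: h4].
pose N e := (Nc e).1.
apply: (@hdg_well_posed R d m Omega T G A divA (normal_mx bA) f gD mu0 N0 N) => //.
- by move=> e /hNc[].
- by move=> e /hNc[].
- move=> K k i j; apply: (Linf_bounded_measurable mO (CsubO K) (A2 k i j)) => x Cx.
  by have [Ox /hN0[[h _] _]] := CO _ _ Cx; exact: (h (k, (i, j))).
- move=> K i j; apply: (Linf_bounded_measurable mO (CsubO K) (A1 i j)) => x Cx.
  by have [Ox /hN0[[_ [h _]] _]] := CO _ _ Cx; exact: (h (i, j)).
- move=> K i j; apply: (Linf_bounded_measurable mO (CsubO K) (A2_div_Linf i j)) => x Cx.
  by have [Ox /hN0[[_ [_ h]] _]] := CO _ _ Cx; exact: (h (i, j)).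
- by move=> K x k /CO[Ox /hN0[_ [h _]]]; exact: h.
- by move=> K x /CO[Ox /hN0[_ [_ h]]]; exact: h.
- move=> e fc he ef; have [_ _ hx] := hNc e he.
  (* The normal is constant on a face, so A is a combination of the bounded boundary values with
     constant coefficients. *)
  apply: bmx_sum => k _; apply: bmxZ => i j.
  apply: (Linf_bounded_measurable (measurable_mortar e) _ (hbA.1 e fc he ef k i j)).
    exact: subDsetl.
  by move=> x /hx[h _ _ _]; exact: (h fc ef (k, (i, j))).
- by move=> e fc x he ef ex; have [_ _ /(_ x ex)[_ h _ _]] := hNc e he; exact: h.
- by move=> e fc x he ef ex; have [_ _ /(_ x ex)[_ _ h _]] := hNc e he; exact: h ef.
- by move=> f1 f2 x he ex; have [_ _ /(_ x ex)[_ _ _ h]] := hNc _ he; exact: h.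
- move=> K i; apply: (L2_rintegrable mO _ (CsubO K) finO (hf i)).
  by apply: measurableD => //; exact: measurable_cell.
- move=> fc i he; have [mNe _ _] := hNc _ he.
  apply: (L2_rintegrable (measurable_mortar _) _ _ (mortar_finite _) (hg fc he i)).
    by apply: measurableD => //; exact: measurable_mortar.
  exact: subDsetl.
- exact: hbA.2.
Qed.
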